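(* Let $(\mathfrak g,[p])$ be a restricted Lie algebra over $k$, let $\mathcal X\subseteq\mathrm{Gr}_2(\mathfrak g)^{V(\mathfrak g)}$ be a closed subset, and let $\varphi:\mathbb P(V_{\mathcal X})\to\mathbb P^m$ be a morphism. (1) The map $$\mathsf{deg}_\varphi:\mathcal X\to\mathbb N_0,\qquad \mathfrak v\mapsto\deg(\varphi|_{\mathbb P(\mathfrak v)})$$ is locally constant. (2) If $\mathcal X$ is connected, then $\mathsf{deg}_\varphi$ is constant.
   Context: $k$ is an algebraically closed field of characteristic $p\ge 3$; all Lie algebras are finite-dimensional over $k$. For a restricted Lie algebra $(\mathfrak g,[p])$ put $V(\mathfrak g)=\{x\in\mathfrak g : x^{[p]}=0\}$ and $\mathrm{Gr}_2(\mathfrak g)^{V(\mathfrak g)}=\{\mathfrak v\in\mathrm{Gr}_2(\mathfrak g) : \mathfrak v\subseteq V(\mathfrak g)\}$, a closed subset of the Grassmannian of two-dimensional subspaces of $\mathfrak g$. For $\mathcal X\subseteq\mathrm{Gr}_2(\mathfrak g)^{V(\mathfrak g)}$ closed, $V_{\mathcal X}:=\bigcup_{\mathfrak v\in\mathcal X}\mathfrak v$, which is a closed conical subset of $V(\mathfrak g)$, and $\mathbb P(V_{\mathcal X})\subseteq\mathbb P(\mathfrak g)$ is the corresponding projective variety (closed subvariety with reduced structure). Degree of a morphism: for a vector space $W$, any morphism $\psi:\mathbb P(W)\to\mathbb P^m$ is given by $\psi(x)=(f_0(x):\cdots:f_m(x))$ with homogeneous polynomial functions $f_0,\dots,f_m$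 on $W$ of a common degree $d$ (some may be zero) and $\gcd(f_0,\dots,f_m)=1$; then $\deg(\psi):=d$, which is well-defined. A map from a topological space to a set is locally constant if every point has an open neighborhood on which the map is constant. *)

(* Defs.v *)
From HB Require Import structures.
From mathcomp Require Import all_boot all_order all_algebra.
From mathcomp Require Import all_classical topology.
From mathcomp Require Import mpoly.

Set Implicit Arguments.
Unset Strict Implicit.
Unset Printing Implicit Defensive.

Import GRing.Theory.
Local Open Scope classical_set_scope.
Local Open Scope ring_scope.

Section Jacobson.
Variables (k : fieldType) (g : vectType k) (br : g -> g -> g).

(* The coefficient of [t ^+ j] in [(ad (t x + y)) ^ n (x)], computed in the
   Lie algebra [g] tensor [k[t]]. *)
Fixpoint ad_pow_coef (x y : g) (n j : nat) : g :=
  match n with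
  | 0 => if j == 0%N then x else 0
  | n'.+1 => br y (ad_pow_coef x y n' j)
             + (if j is j'.+1 then br x (ad_pow_coef x y n' j') else 0)
  end.

(* Jacobson's [s_i], given for [0 < i < p] by
   (ad (t x + y)) ^ (p - 1) (x) = \sum_(0 < i < p) i * s_i(x, y) * t ^ (i - 1). *)
Definition jacobson_s (p : nat) (x y : g) (i : nat) : g :=
  (i%:R : k)^-1 *: ad_pow_coef x y p.-1 i.-1.

End Jacobson.

Record restrictedLieAlgebra (k : fieldType) (p : nat) (g : vectType k) := {
  lie_br : g -> g -> g;
  lie_pmap : g -> g;
  lie_linearl : forall (a : k) (x y z : g),
    lie_br (a *: x + y) z = a *: lie_br x z + lie_br y z;
  lie_linearr : forall (a : k) (x y z : g),
    lie_br z (a *: x + y) = a *: lie_br z x + lie_br z y;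
  lie_alt : forall x : g, lie_br x x = 0;
  lie_jacobi : forall x y z : g,
    lie_br x (lie_br y z) + lie_br y (lie_br z x) + lie_br z (lie_br x y) = 0;
  lie_pmap_ad : forall x y : g, lie_br (lie_pmap x) y = iter p (lie_br x) y;
  lie_pmapZ : forall (a : k) (x : g), lie_pmap (a *: x) = a ^+ p *: lie_pmap x;
  lie_pmapD : forall x y : g,
    lie_pmap (x + y) = lie_pmap x + lie_pmap y
                       + \sum_(1 <= i < p) jacobson_s lie_br p x y i }.

Section Proj.
Variables (k : fieldType) (V : vectType k).

(* The value at [x] of the polynomial function on the subspace [W] given by [F]
   in the coordinates of the basis [vbasis W]; meaningful only for [x \in W]. *)
Definition peval (W : {vspace V}) (F : {mpoly k[\dim W]}) (x : V) : k :=
  F.@[fun i => coord (vbasis W) i x].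

Record proj_space := Proj {
  proj_line :> {vspace V};
  proj_dim : \dim proj_line == 1%N }.

HB.instance Definition _ := [isSub for proj_line].
HB.instance Definition _ := [Choice of proj_space by <:].

Definition homogeneous_poly : set {mpoly k[\dim (@fullv k V)]} :=
  [set F | exists d, F \is d.-homog].

Definition zero_locus (S : set {mpoly k[\dim (@fullv k V)]}) : set proj_space :=
  [set L : proj_space | forall F, S F -> forall x, x \in (L : {vspace V}) -> peval F x = 0].

Definition zariski_open (O : set proj_space) : Prop :=
  exists2 S, S `<=` homogeneous_poly & O = ~` zero_locus S.

Lemma zariski_openT : zariski_open setT.
Proof.
exists [set 1] => [F ->|]; first by exists 0%N; apply: dhomog1.
apply/seteqP; split=> // L _ /(_ 1 erefl 0 (mem0v _)).
by rewrite /peval meval1 => /eqP; rewrite oner_eq0.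
Qed.

Lemma line_scale (L : proj_space) (x y : V) : x \in (L : {vspace V}) ->
  y \in (L : {vspace V}) -> x != 0 -> exists a, y = a *: x.
Proof.
move=> xL yL x0; apply/vlineP; suff -> : <[x]>%VS = L by [].
by apply/eqP; rewrite eqEdim -memvE xL (eqP (proj_dim L)) dim_vline x0.
Qed.

Lemma pevalZ (W : {vspace V}) (d : nat) (F : {mpoly k[\dim W]}) a x :
  F \is d.-homog -> peval F (a *: x) = a ^+ d * peval F x.
Proof.
move=> hF; rewrite /peval !mevalE big_distrr /= big_seq [RHS]big_seq.
apply: eq_bigr => m mF; rewrite mulrCA; congr (_ * _).
have := dhomog_mf hF mF; rewrite /= mdegE => <-.
under eq_bigr do rewrite linearZ /= exprMn.
rewrite big_split /=; congr (_ * _).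
by rewrite prodrXr.
Qed.

Lemma zariski_openI : setI_closed zariski_open.
Proof.
move=> _ _ [S1 h1 ->] [S2 h2 ->].
exists [set F | exists F1 F2, [/\ S1 F1, S2 F2 & F = F1 * F2]].
  move=> _ [F1 [F2 [/h1[d1 H1] /h2[d2 H2] ->]]].
  by exists (d1 + d2)%N; apply: dhomogM.
rewrite -setCU; congr (~` _); apply/seteqP; split=> L.
  case=> h _ [F1 [F2 [S1F S2F ->]]] x xL; rewrite /peval mevalM.
    by rewrite -/(peval F1 x) (h _ S1F _ xL) mul0r.
  by rewrite -/(peval F2 x) (h _ S2F _ xL) mulr0.
move=> h; apply: contrapT => /not_orP[].
move=> /existsNP[F1 /not_implyP[S1F /existsNP[x /not_implyP[xL /eqP nx]]]].
move=> /existsNP[F2 /not_implyP[S2F /existsNP[y /not_implyP[yL /eqP ny]]]].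
have [d1 H1] := h1 _ S1F; have [d2 H2] := h2 _ S2F.
have [z0 [zL zx zy]] : exists z, [/\ z \in (L : {vspace V}),
    peval F1 z != 0 & peval F2 z != 0].
  have [x0|x0] := eqVneq x 0.
    exists y; split=> //; apply: contra nx => /eqP.
    have -> : x = 0 *: y by rewrite scale0r.
    by rewrite (pevalZ _ _ H1) => ->; rewrite mulr0.
  have [a ya] := line_scale xL yL x0.
  exists x; split=> //; apply: contra ny => /eqP.
  by rewrite ya (pevalZ _ _ H2) => ->; rewrite mulr0.
have /eqP := h _ (ex_intro _ F1 (ex_intro _ F2 (And3 S1F S2F erefl))) _ zL.
by rewrite /peval mevalM mulf_eq0 -!/(peval _ _) (negbTE zx) (negbTE zy).
Qed.

Lemma zariski_open_bigU (I : Type) (f : I -> set proj_space) :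
  (forall i, zariski_open (f i)) -> zariski_open (\bigcup_i f i).
Proof.
move=> hf; pose S i := projT1 (cid2 (hf i)).
have hS i : S i `<=` homogeneous_poly /\ f i = ~` zero_locus (S i).
  by rewrite /S; case: cid2.
exists (\bigcup_i S i) => [F [i _ SF]|]; first exact: (hS i).1.
apply/seteqP; split=> L.
  case=> i _; rewrite (hS i).2 => nL zL; apply: nL => F SF.
  by apply: zL; exists i.
move=> nL; apply: contrapT => nU; apply: nL => F [i _ SF] x xL.
apply: contrapT => Fx; apply: nU; exists i => //.
by rewrite (hS i).2 => zL; apply: Fx; exact: zL xL.
Qed.

HB.instance Definition _ :=
  isOpenTopological.Build proj_space zariski_openT zariski_openI zariski_open_bigU.

(* Meant for [A] locally closed in P(V). *)
Definition regular_function (A : set proj_space) (f : proj_space -> k) : Prop :=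
  forall L : proj_space, A L -> exists O : set proj_space, [/\ open O, O L &
    exists d (G H : {mpoly k[\dim (@fullv k V)]}),
      [/\ G \is d.-homog, H \is d.-homog &
       forall M : proj_space, O M -> A M ->
         forall x, x \in (M : {vspace V}) -> x != 0 ->
           peval H x != 0 /\ f M = peval G x / peval H x]].

End Proj.

(* The reduced variety structure on [A] is the one induced from P(V); values of
   [phi] outside [A] are irrelevant. *)
Definition morphism_on (k : fieldType) (V U : vectType k)
    (A : set (proj_space V)) (phi : proj_space V -> proj_space U) : Prop :=
  {within A, continuous phi} /\
  (forall (O : set (proj_space U)) (f : proj_space U -> k), open O ->
     regular_function O f -> regular_function (A `&` phi @^-1` O) (f \o phi)).

Section Gr2.
Variables (k : fieldType) (V : vectType k).

Record gr2 := Gr2 {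
  gr2_plane :> {vspace V};
  gr2_dim : \dim gr2_plane == 2%N }.

HB.instance Definition _ := [isSub for gr2_plane].
HB.instance Definition _ := [Choice of gr2 by <:].

(* The bivector [x /\ y] in coordinates, as an alternating matrix. *)
Definition bivector (x y : V) : 'M[k]_(\dim (@fullv k V)) :=
  let c (z : V) i := coord (vbasis fullv) i z in
  \matrix_(i, j) (c x i * c y j - c x j * c y i).

Definition pluecker_line (v : gr2) : {vspace 'M[k]_(\dim (@fullv k V))} :=
  <[bivector (vbasis v)`_0 (vbasis v)`_1]>%VS.

Lemma pluecker_dim v : \dim (pluecker_line v) == 1%N.
Proof.
have := basis_free (vbasisP v); have := size_tuple (vbasis v).
rewrite /pluecker_line; move: (tval (vbasis v)) => s.
rewrite (eqP (gr2_dim v)); case: s => [|x [|y []]] //= _ fxy; rewrite dim_vline.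
suff -> : bivector x y != 0 by [].
apply/eqP => /matrixP w0; move: fxy; rewrite free_cons free_cons.
rewrite span_seq1 => /and3P[/vlineP xy]; rewrite span_nil memv0 => y0 _.
pose c (z : V) i := coord (vbasis (@fullv k V)) i z.
have cE z : z = \sum_i c z i *: (vbasis fullv)`_i.
  by rewrite -(coord_vbasis (memvf z)).
have [i yi] : exists i, c y i != 0.
  apply/existsP; apply: contraNT y0 => /existsPn y0.
  rewrite (cE y) big1 // => i _.
  by have /negPn/eqP -> := y0 i; rewrite scale0r.
have [a ea] : exists a, a = c x i / c y i by eexists.
apply: xy; exists a.
rewrite (cE x) (cE y) scaler_sumr; apply: eq_bigr => j _.
rewrite scalerA ea; congr (_ *: _); have := w0 i j.
rewrite !mxE => /eqP; rewrite subr_eq0 => /eqP xy.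
by have e : c x i * c y j = c x j * c y i := xy; rewrite mulrAC e mulfK.
Qed.

Definition pluecker (v : gr2) : proj_space 'M[k]_(\dim (@fullv k V)) :=
  Proj (pluecker_dim v).

HB.instance Definition _ := Topological.copy gr2 (initial_topology pluecker).

End Gr2.

Definition poly_gcd_is_one (k : fieldType) (n m : nat)
    (f : 'I_m -> {mpoly k[n]}) : Prop :=
  forall h : {mpoly k[n]},
    (forall i, exists q, f i = q * h) -> h \is a GRing.unit.

Section Degree.
Variables (k : fieldType) (V : vectType k) (m : nat).

(* Only the restriction of [psi] to the lines of [W] matters. Since the right-hand
   side below is a line, the [f i] have no common zero on [W] except 0. *)
Definition is_degree (W : {vspace V}) (psi : proj_space V -> proj_space 'rV[k]_m.+1)
    (d : nat) : Prop :=
  exists f : 'I_m.+1 -> {mpoly k[\dim W]},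
    [/\ forall i, f i \is d.-homog,
        poly_gcd_is_one f &
        forall L : proj_space V, (L <= W)%VS ->
          forall x, x \in (L : {vspace V}) -> x != 0 ->
            (psi L : {vspace 'rV[k]_m.+1}) = <[\row_i peval (f i) x]>%VS].

(* For [k] algebraically closed, [W] nonzero and [psi] a morphism on P(W), the
   degree exists and is unique; 0 is a dummy default. *)
Definition degree (W : {vspace V}) (psi : proj_space V -> proj_space 'rV[k]_m.+1) : nat :=
  xget 0%N [set d | is_degree W psi d].

End Degree.

Section Varieties.
Variables (k : fieldType) (p : nat) (g : vectType k).

Definition null_cone (L : restrictedLieAlgebra p g) : set g :=
  [set x | lie_pmap L x = 0].

Definition gr2_null (L : restrictedLieAlgebra p g) : set (gr2 g) :=
  [set v : gr2 g | [set` (v : {vspace g})] `<=` null_cone L].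

Definition union_planes (X : set (gr2 g)) : set g :=
  \bigcup_(v in X) [set` (v : {vspace g})].

(* [C] is meant to be conical: a line is in P(C) when it is included in [C]. *)
Definition projectivization (C : set g) : set (proj_space g) :=
  [set l : proj_space g | [set` (l : {vspace g})] `<=` C].

End Varieties.

Definition locally_constant_on (T : topologicalType) (Y : Type)
    (X : set T) (f : T -> Y) : Prop :=
  forall x, X x -> exists O : set T,
    [/\ open O, O x & forall y, O y -> X y -> f y = f x].

(* Main.v *)
(* Near a given line, a morphism [phi] is given by homogeneous forms [G_b] of a
   common degree [D]. On a plane [v] of [X] meeting their domain, [G_b = h f_b]
   where the [f_b] are the coprime forms of degree [deg v] describing [phi] on
   P(v). If the [G_b] have no common zero at the point at infinity of P(v), then,
   in an affine coordinate on P(v), [h] is the gcd of the [G_b] and has degree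
   [D - deg v]. The degree of the gcd of a family of polynomials in one variable is
   upper semicontinuous in the coefficients, being the corank of a matrix of
   Sylvester type; hence [deg] is lower semicontinuous. Conversely a nonzero
   component [f_a] is a gcd of the components [G_a] of finitely many local
   representations covering P(v), so [deg] is upper semicontinuous as well. *)

Require Import Defs.
From HB Require Import structures.
From mathcomp Require Import all_boot all_order all_algebra.
From mathcomp Require Import all_classical topology.
From mathcomp Require Import mpoly zify.

Set Implicit Arguments.
Unset Strict Implicit.
Unset Printing Implicit Defensive.

Import GRing.Theory.
Local Open Scope classical_set_scope.
Local Open Scope ring_scope.

(** * Ideals and common divisors of polynomials in one variable *)

Section Univariate.

Lemma ideal_generator (k : fieldType) (I : {poly k} -> Prop) :
  (forall p q r, I p -> I q -> I (p + r * q)) ->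
  (exists2 p, I p & p != 0) ->
  exists g, [/\ I g, g != 0 & forall q, I q -> g %| q].
Proof.
move=> Icl [p0 Ip0 p0n0].
have ex : exists n, `[< exists p, [/\ I p, p != 0 & size p = n] >].
  by exists (size p0); apply/asboolP; exists p0.
case: (ex_minnP ex) => n /asboolP[g [Ig gn0 sg]] minn; exists g; split=> // q Iq.
apply: contraT => ngq.
have Ir : I (q %% g).
  have -> : q %% g = q + (- (q %/ g)) * g.
    by rewrite {2}(divp_eq q g) mulNr addrAC subrr add0r.
  exact: Icl.
have := minn (size (q %% g)).
rewrite leqNgt -sg ltn_modp gn0 => /(_ _)/negP[] //.
by apply/asboolP; exists (q %% g).
Qed.

(** One-variable Nullstellensatz: a root of the generator would be a common zero of [I]. *)
Lemma ideal_one (k : closedFieldType) (I : {poly k} -> Prop) :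
  (forall p q r, I p -> I q -> I (p + r * q)) ->
  (forall t, exists2 p, I p & p.[t] != 0) -> I 1.
Proof.
move=> Icl Int.
have [g [Ig gn0 gI]] : exists g, [/\ I g, g != 0 & forall q, I q -> g %| q].
  apply: ideal_generator => //; have [p Ip pt] := Int 0; exists p => //.
  by apply: contraNneq pt => ->; rewrite horner0.
have /eqP/size_poly1P[c cn0 gc] : size g = 1.
  apply/eqP; apply/negPn/negP => /closed_rootP[t gt].
  have [p Ip /negP[]] := Int t.
  by rewrite -(divpK (gI _ Ip)) hornerM (rootP gt) mulr0.
have -> : 1 = g + (c^-1 - 1)%:P * g.
  by rewrite gc -polyCM -polyCD mulrBl mul1r mulVf // addrC subrK.
exact: Icl.
Qed.

Lemma bezout_family (k : closedFieldType) m (f : 'I_m -> {poly k}) :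
  (forall t, exists i, (f i).[t] != 0) ->
  exists a : 'I_m -> {poly k}, \sum_i a i * f i = 1.
Proof.
move=> fnz.
apply: (@ideal_one _ (fun p => exists a : 'I_m -> {poly k}, \sum_i a i * f i = p)).
  move=> _ _ r [a <-] [b <-]; exists (fun i => a i + r * b i).
  rewrite mulr_sumr -big_split /=; apply: eq_bigr => i _.
  by rewrite mulrDl mulrA.
move=> t; have [i fi] := fnz t; exists (f i) => //.
exists (fun j => (i == j)%:R).
rewrite (bigD1 i) //= eqxx mul1r big1 ?addr0 // => j /negbTE.
by rewrite eq_sym => ->; rewrite mul0r.
Qed.

(* The vectors [R i] lie in the space of multiples of [gamma] of degree at most
   [K], whose dimension is [K + 1 - deg gamma]. *)
Lemma common_divisor_size (k : fieldType) (K c : nat)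
    (R : 'I_(K.+1 - c) -> {poly k}) (gamma : {poly k}) :
  (c <= K)%N -> (forall i, (size (R i) <= K.+1)%N) ->
  (forall i, gamma %| R i) ->
  \det (\matrix_(i, j) (R i)`_(c + j)) != 0 ->
  (size gamma <= c.+1)%N.
Proof.
move=> cK sR gR detn0; rewrite leqNgt; apply/negP => cg.
set M := (X in \det X) in detn0.
pose N' := (K.+1 - (size gamma).-1)%N.
pose u i := R i %/ gamma.
have gn0 : gamma != 0 by rewrite -size_poly_gt0; lia.
have su i : (size (u i) <= N')%N.
  by rewrite /u size_divp // leq_sub2r.
(* Expanding each [R i] in the ['X^l * gamma] with [l < N'] factors [M] through dimension [N'],
   which is less than the size of [M] if [deg gamma > c]. *)
have eM : M = (\matrix_(i < K.+1 - c, l < N') (u i)`_l)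
   *m (\matrix_(l < N', j < K.+1 - c) ('X^l * gamma)`_(c + j)).
  apply/matrixP => i j; rewrite !mxE.
  have ue : u i = \sum_(l < N') (u i)`_l *: 'X^l.
    rewrite -poly_def; apply/polyP => l; rewrite coef_poly.
    by case: ltnP => // h; rewrite nth_default // (leq_trans (su i)).
  rewrite -(divpK (gR i)) -/(u i) {1}ue mulr_suml coef_sum.
  by apply: eq_bigr => l _; rewrite !mxE -scalerAl coefZ.
have Mu : M \in unitmx by rewrite unitmxE unitfE.
have := mxrank_unit Mu; rewrite eM => rM.
have := mulmx_max_rank (\matrix_(i < K.+1 - c, l < N') (u i)`_l)
   (\matrix_(l < N', j < K.+1 - c) ('X^l * gamma)`_(c + j)).
by rewrite rM /N'; lia.
Qed.

End Univariate.

(** * Polynomial functions and semicontinuity of the gcd *)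

Section PolyFun.
Variables (k : fieldType) (V : vectType k).
Implicit Types (f g : V -> k).

Definition polyfun f := exists F : {mpoly k[\dim (@fullv k V)]}, forall x, f x = peval F x.

Lemma eq_polyfun f g : f =1 g -> polyfun f -> polyfun g.
Proof. by move=> fg [F hF]; exists F => x; rewrite -fg. Qed.

Lemma polyfunC c : polyfun (fun=> c).
Proof. by exists c%:MP => x; rewrite /peval mevalC. Qed.

Lemma polyfunD f g : polyfun f -> polyfun g -> polyfun (fun x => f x + g x).
Proof. by move=> [F hF] [G hG]; exists (F + G) => x; rewrite /peval mevalD hF hG. Qed.

Lemma polyfunM f g : polyfun f -> polyfun g -> polyfun (fun x => f x * g x).
Proof. by move=> [F hF] [G hG]; exists (F * G) => x; rewrite /peval mevalM hF hG. Qed.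

Lemma polyfun_sum I (r : seq I) (P : pred I) (F : I -> V -> k) :
  (forall i, polyfun (F i)) -> polyfun (fun x => \sum_(i <- r | P i) F i x).
Proof.
move=> hF; elim: r => [|i r IH].
  by apply: eq_polyfun (polyfunC 0) => x; rewrite big_nil.
apply: (@eq_polyfun (fun x => (if P i then F i x else 0) + \sum_(j <- r | P j) F j x)).
  by move=> x; rewrite big_cons; case: (P i) => //; rewrite add0r.
by apply: polyfunD => //; case: (P i) => //; apply: polyfunC.
Qed.

Lemma polyfun_prod I (r : seq I) (P : pred I) (F : I -> V -> k) :
  (forall i, polyfun (F i)) -> polyfun (fun x => \prod_(i <- r | P i) F i x).
Proof.
move=> hF; elim: r => [|i r IH].
  by apply: eq_polyfun (polyfunC 1) => x; rewrite big_nil.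
apply: (@eq_polyfun (fun x => (if P i then F i x else 1) * \prod_(j <- r | P j) F j x)).
  by move=> x; rewrite big_cons; case: (P i) => //; rewrite mul1r.
by apply: polyfunM => //; case: (P i) => //; apply: polyfunC.
Qed.

Lemma polyfunX f n : polyfun f -> polyfun (fun x => f x ^+ n).
Proof.
move=> hf; apply: (@eq_polyfun (fun x => \prod_(i < n) f x)).
  by move=> x; rewrite prodr_const card_ord.
exact: polyfun_prod.
Qed.

Lemma polyfun_meval n (F : {mpoly k[n]}) (c : 'I_n -> V -> k) :
  (forall i, polyfun (c i)) -> polyfun (fun x => F.@[fun i => c i x]).
Proof.
move=> hc; apply: (@eq_polyfun (fun x =>
    \sum_(m <- msupp F) F@_m * \prod_i c i x ^+ m i)) => [x|].
  by rewrite mevalE.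
apply: polyfun_sum => m; apply: polyfunM; first exact: polyfunC.
by apply: polyfun_prod => i; apply: polyfunX.
Qed.

Lemma polyfun_det n (A : V -> 'M[k]_n) :
  (forall i j, polyfun (fun x => A x i j)) -> polyfun (fun x => \det (A x)).
Proof.
move=> hA; apply: polyfun_sum => s; apply: polyfunM; first exact: polyfunC.
by apply: polyfun_prod.
Qed.

(** The uniform bound on the sizes lets a Sylvester-type matrix of fixed format serve all
    parameters. *)
Definition polyfam (P : V -> {poly k}) :=
  (exists E, forall x, (size (P x) <= E)%N) /\ forall i, polyfun (fun x => (P x)`_i).

Lemma polyfamC p : polyfam (fun=> p).
Proof. by split=> [|i]; [exists (size p) | apply: polyfunC]. Qed.

Lemma polyfamD P Q : polyfam P -> polyfam Q -> polyfam (fun x => P x + Q x).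
Proof.
move=> [[E hE] hP] [[E' hE'] hQ]; split.
  exists (maxn E E') => x; apply: leq_trans (size_polyD _ _) _.
  by have := hE x; have := hE' x; lia.
by move=> i; apply: eq_polyfun (polyfunD (hP i) (hQ i)) => x; rewrite coefD.
Qed.

Lemma polyfamM P Q : polyfam P -> polyfam Q -> polyfam (fun x => P x * Q x).
Proof.
move=> [[E hE] hP] [[E' hE'] hQ]; split.
  exists (E + E')%N => x; apply: leq_trans (size_polyMleq _ _) _.
  by have := hE x; have := hE' x; lia.
move=> i; apply: (@eq_polyfun (fun x => \sum_(j < i.+1) (P x)`_j * (Q x)`_(i - j))).
  by move=> x; rewrite coefM.
by apply: polyfun_sum => j; apply: polyfunM.
Qed.

Lemma polyfam_sum I (r : seq I) (F : I -> V -> {poly k}) :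
  (forall i, polyfam (F i)) -> polyfam (fun x => \sum_(i <- r) F i x).
Proof.
move=> hF; suff -> : (fun x => \sum_(i <- r) F i x) =
    \big[(fun P Q x => P x + Q x)/(fun=> 0)]_(i <- r) F i.
  by elim/big_ind : _ => //; [apply: polyfamC | apply: polyfamD].
apply/funext => x; elim: r => [|i r IH]; first by rewrite !big_nil.
by rewrite !big_cons IH.
Qed.

Lemma polyfam_prod I (r : seq I) (F : I -> V -> {poly k}) :
  (forall i, polyfam (F i)) -> polyfam (fun x => \prod_(i <- r) F i x).
Proof.
move=> hF; suff -> : (fun x => \prod_(i <- r) F i x) =
    \big[(fun P Q x => P x * Q x)/(fun=> 1)]_(i <- r) F i.
  by elim/big_ind : _ => //; [apply: polyfamC | apply: polyfamM].
apply/funext => x; elim: r => [|i r IH]; first by rewrite !big_nil.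
by rewrite !big_cons IH.
Qed.

(* Multiples [X^i Q] and [X^j P] of distinct degrees at [x0] give a triangular
   minor, which stays nonzero near [x0]. *)
Lemma common_divisor_semicontinuous (P Q : V -> {poly k}) (D : nat) (x0 : V) :
  polyfam P -> polyfam Q -> (forall x, (size (P x) <= D.+1)%N) ->
  (P x0)`_D != 0 -> Q x0 != 0 -> (size (Q x0) <= D.+1)%N ->
  exists delta : V -> k, [/\ polyfun delta, delta x0 != 0 &
    forall x gamma, delta x != 0 -> gamma %| P x -> gamma %| Q x ->
      (size gamma <= size (Q x0))%N].
Proof.
move=> [_ pP] [[E sQ] pQ] sP Pn0 Qn0 sQ0.
pose c := (size (Q x0)).-1.
have sQ0E : size (Q x0) = c.+1 by rewrite prednK // size_poly_gt0.
have cD : (c <= D)%N by rewrite sQ0E in sQ0.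
(* [Q x] may have degree above [c] when [x] is not [x0]; by the bound [E] all rows still fit in
   degree [K]. At [x0] the rows from [Q] have degrees [c] to [D - 1] and those from [P] degrees [D]
   to [K], so row [i] has degree [c + i]. *)
pose K := (D + E)%N.
pose R x (i : 'I_(K.+1 - c)) :=
  if (i < D - c)%N then 'X^i * Q x else 'X^(i - (D - c)) * P x.
pose M x : 'M_(K.+1 - c) := \matrix_(i, j) (R x i)`_(c + j).
exists (fun x => \det (M x)); split.
- apply: polyfun_det => i j.
  apply: (@eq_polyfun (fun x => if (i < D - c)%N then
       if (c + j < i)%N then 0 else (Q x)`_(c + j - i) else
       if (c + j < i - (D - c))%N then 0 else (P x)`_(c + j - (i - (D - c))))).
    by move=> x; rewrite mxE /R; case: ifP => _; rewrite coefXnM.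
  case: (i < D - c)%N; first by case: (c + j < i)%N; [apply: polyfunC | apply: pQ].
  by case: (c + j < i - (D - c))%N; [apply: polyfunC | apply: pP].
- rewrite det_trig.
    apply/prodf_neq0 => i _; rewrite mxE /R; case: ltnP => h; rewrite coefXnM.
      rewrite ltnNge leq_addl /= addnK /c.
      by move: Qn0; rewrite -lead_coef_eq0.
    have -> : (c + i < i - (D - c))%N = false by lia.
    by have -> : (c + i - (i - (D - c)) = D)%N by lia.
  apply/is_trig_mxP => i j ij; rewrite mxE /R; case: ltnP => h; rewrite coefXnM.
    case: ifP => // _; rewrite nth_default // sQ0E.
    by move: ij h; clearbody c; lia.
  case: ifP => // _; rewrite nth_default //; apply: leq_trans (sP _) _; lia.
- move=> x gamma dn0 gP gQ; rewrite sQ0E.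
  apply: (common_divisor_size _ _ _ dn0); first by rewrite /K; lia.
    move=> i; have := ltn_ord i; rewrite {1}/K /R => iN.
    case: ltnP => h; apply: leq_trans (size_polyMleq _ _) _; rewrite size_polyXn.
      move: (sQ x) h; move: (size (Q x)) => n; rewrite /K; clearbody c; lia.
    move: (sP x) h; move: (size (P x)) => n; rewrite /K; clearbody c; lia.
  by move=> i; rewrite /R; case: ifP => _; apply: dvdp_mull.
Qed.

End PolyFun.

(** * Binary forms *)

Section Restriction.

(** The polynomial [p - q + 1] takes only the value 1, so it has no root and is constant. *)
Lemma poly_eq_horner (k : closedFieldType) (p q : {poly k}) :
  (forall t, p.[t] = q.[t]) -> p = q.
Proof.
move=> pq; apply/eqP; rewrite -subr_eq0; apply/eqP.
have /eqP/size_poly1P[c _ pqc] : size (p - q + 1) = 1.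
  apply/eqP; apply/negPn/negP => /closed_rootP[t] /rootP.
  by rewrite !hornerE pq subrr add0r => /eqP; rewrite oner_eq0.
have := congr1 (horner^~ 0) pqc; rewrite !hornerE pq subrr add0r => c1.
by apply: (addIr 1); rewrite pqc -c1 add0r.
Qed.

(** [c] is the coefficient at a formal degree [d] and may be zero, so the notion is multiplicative
    without nonvanishing conditions. *)
Definition has_top (k : fieldType) (d : nat) (c : k) (p : {poly k}) :=
  (size p <= d.+1)%N /\ p`_d = c.

Lemma has_topM (k : fieldType) d e (a b : k) p q :
  has_top d a p -> has_top e b q -> has_top (d + e) (a * b) (p * q).
Proof.
move=> [sp pd] [sq qe]; split.
  apply: leq_trans (size_polyMleq _ _) _.
  by move: sp sq; move: (size p) (size q) => u v; lia.
have ltd : (d < (d + e).+1)%N by lia.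
rewrite coefM (bigD1 (Ordinal ltd)) //= addKn pd qe big1 ?addr0 // => j.
rewrite -val_eqE /= => jd; case: (ltngtP j d) jd => // h _.
  rewrite [q`__]nth_default ?mulr0 //; apply: leq_trans sq _; lia.
by rewrite nth_default ?mul0r //; apply: leq_trans sp _; lia.
Qed.

Lemma has_top_prod (k : fieldType) I (r : seq I) (d : I -> nat) (c : I -> k) p :
  (forall i, has_top (d i) (c i) (p i)) ->
  has_top (\sum_(i <- r) d i) (\prod_(i <- r) c i) (\prod_(i <- r) p i).
Proof.
move=> h; elim/big_rec3: _ => [|i P C D _ IH]; last exact: has_topM.
by split; rewrite ?size_poly1 // coef1.
Qed.

Lemma has_topX (k : fieldType) d n (c : k) p :
  has_top d c p -> has_top (d * n) (c ^+ n) (p ^+ n).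
Proof.
move=> h; have := @has_top_prod _ _ (index_enum 'I_n) (fun=> d) (fun=> c) (fun=> p) (fun=> h).
by rewrite !prodr_const sum_nat_const card_ord mulnC.
Qed.

Variable k : closedFieldType.

Definition line_mpoly n (F : {mpoly k[n]}) (x y : 'I_n -> k) : {poly k} :=
  \sum_(m <- msupp F) (F@_m)%:P * \prod_i ((x i)%:P + (y i)%:P * 'X) ^+ m i.

Lemma horner_line_mpoly n (F : {mpoly k[n]}) x y t :
  (line_mpoly F x y).[t] = F.@[fun i => x i + t * y i].
Proof.
rewrite mevalE horner_sum; apply: eq_bigr => m _.
rewrite hornerM hornerC horner_prod; congr (_ * _); apply: eq_bigr => i _.
by rewrite !hornerE mulrC.
Qed.

(** [y] is the point at infinity of the line [x + t y]: in a monomial of degree [d], the coefficient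
    of [t^d] takes the [y] part of every factor. *)
Lemma line_mpoly_top n (F : {mpoly k[n]}) d (x y : 'I_n -> k) : F \is d.-homog ->
  has_top d F.@[y] (line_mpoly F x y).
Proof.
move=> hF; rewrite mevalE /line_mpoly.
have hm m : m \in msupp F -> has_top d (F@_m * \prod_i y i ^+ m i)
    ((F@_m)%:P * \prod_i ((x i)%:P + (y i)%:P * 'X) ^+ m i).
  move=> mF; have /= <- := dhomog_mf hF mF.
  rewrite mdegE; apply: (@has_topM _ 0).
    by split; rewrite ?coefC // size_polyC; case: eqP.
  apply: has_top_prod => i; rewrite -[X in has_top X]mul1n; apply: has_topX.
  split; last by rewrite !coefE /= add0r mulr1.
  apply: leq_trans (size_polyD _ _) _; rewrite geq_max.
  rewrite (leq_trans (size_polyC_leq1 _)) //=.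
  apply: leq_trans (size_polyMleq _ _) _; rewrite size_polyX addn2 /=.
  exact: leq_trans (size_polyC_leq1 _) _.
split.
  apply: leq_trans (size_sum _ _ _) _; apply/bigmax_leqP_seq => m mF _.
  by have [] := hm m mF.
rewrite coef_sum big_seq [RHS]big_seq; apply: eq_bigr => m mF.
by have [] := hm m mF.
Qed.

Lemma meval_homogZ n d (F : {mpoly k[n]}) a z : F \is d.-homog ->
  F.@[fun i => a * z i] = a ^+ d * F.@[z].
Proof.
move=> hF; rewrite !mevalE big_distrr /= big_seq [RHS]big_seq.
apply: eq_bigr => m mF; rewrite mulrCA; congr (_ * _).
have := dhomog_mf hF mF; rewrite /= mdegE => <-.
under eq_bigr do rewrite exprMn.
by rewrite big_split /= prodrXr.
Qed.

Definition pt (a b : k) : 'I_2 -> k := fun i => if i == ord0 then a else b.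

(** Here [line_mpoly F (pt 1 0) (pt 0 1)] is the dehomogenization F(1, t); its coefficient of degree
    [d] is the value at infinity. *)
Lemma meval_pt0 (F : {mpoly k[2]}) d b : F \is d.-homog ->
  F.@[pt 0 b] = b ^+ d * (line_mpoly F (pt 1 0) (pt 0 1))`_d.
Proof.
move=> hF; have [_ ->] := line_mpoly_top (pt 1 0) (pt 0 1) hF.
rewrite -meval_homogZ //; apply: meval_eq => i.
by rewrite /pt; case: eqP => _; rewrite ?mulr0 ?mulr1.
Qed.

Lemma meval_ptn0 (F : {mpoly k[2]}) d a b : F \is d.-homog -> a != 0 ->
  F.@[pt a b] = a ^+ d * (line_mpoly F (pt 1 0) (pt 0 1)).[b / a].
Proof.
move=> hF an0; rewrite horner_line_mpoly -meval_homogZ //; apply: meval_eq => i.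
rewrite /pt; case: eqP => _; first by rewrite mulr0 addr0 mulr1.
by rewrite mulr1 add0r mulrCA divff ?mulr1.
Qed.

Lemma homogenization (d : nat) (r : {poly k}) : (size r <= d.+1)%N ->
  exists2 F : {mpoly k[2]}, F \is d.-homog &
    line_mpoly F (pt 1 0) (pt 0 1) = r.
Proof.
move=> sr.
exists (\sum_(j < d.+1) r`_j *: ('X_ord0 ^+ (d - j) * 'X_ord_max ^+ j)).
  apply: rpred_sum => j _; apply: dhomogZ.
  rewrite -[X in X.-homog](subnK (ltn_ord j : (j <= d)%N)).
  by apply: dhomogM; rewrite -[X in X.-homog]mul1n; apply: dhomogMn;
    rewrite dhomogX /= mdeg1.
apply: poly_eq_horner => t; rewrite horner_line_mpoly raddf_sum /=.
rewrite (horner_coef_wide _ sr); apply: eq_bigr => j _.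
rewrite mevalZ mevalM !rmorphXn /= !mevalXU /pt /=.
by rewrite mulr0 addr0 expr1n mul1r add0r mulr1.
Qed.

Lemma eq_pt (z : 'I_2 -> k) : z =1 pt (z ord0) (z ord_max).
Proof.
move=> i; rewrite /pt; have [->//|] := eqVneq i ord0.
by case: i => -[|[|]] //= h _; congr z; apply: val_inj.
Qed.

(** Dehomogenize, divide by the gcd [gam], homogenize again. The quotients [r i] have no common zero
    at finite points by Bezout, and none at infinity since [d] is the largest of their degrees. The
    last clause expresses proportionality to [g] by 2x2 minors. *)
Lemma homog_reduce m D (g : 'I_m -> {mpoly k[2]}) :
  (forall i, g i \is D.-homog) -> (exists i z, (g i).@[z] != 0) ->
  exists d (f : 'I_m -> {mpoly k[2]}),
    [/\ forall i, f i \is d.-homog,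
        forall z, (exists j, z j != 0) -> exists i, (f i).@[z] != 0 &
        forall z i j, (f i).@[z] * (g j).@[z] = (f j).@[z] * (g i).@[z]].
Proof.
move=> hg [i0 [z0 gz0]].
pose p i := line_mpoly (g i) (pt 1 0) (pt 0 1).
pose I q := exists a : 'I_m -> {poly k}, \sum_i a i * p i = q.
have Ip i : I (p i).
  exists (fun j => (i == j)%:R).
  rewrite (bigD1 i) //= eqxx mul1r big1 ?addr0 // => j /negbTE.
  by rewrite eq_sym => ->; rewrite mul0r.
have [gam [[a ag] gn0 gI]] : exists g, [/\ I g, g != 0 & forall q, I q -> g %| q].
  apply: ideal_generator.
    move=> _ _ r [a <-] [b <-]; exists (fun i => a i + r * b i).
    rewrite mulr_sumr -big_split /=; apply: eq_bigr => i _.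
    by rewrite mulrDl mulrA.
  exists (p i0) => //; apply: contraNneq gz0 => p0.
  rewrite (meval_eq _ (eq_pt z0)).
  have [->|zn0] := eqVneq (z0 ord0) 0.
    by rewrite (meval_pt0 _ (hg i0)) -/(p i0) p0 coef0 mulr0.
  by rewrite (meval_ptn0 _ (hg i0)) // -/(p i0) p0 horner0 mulr0.
pose r i := p i %/ gam.
have pr i : p i = r i * gam by rewrite /r divpK //; apply: gI.
have ar : \sum_i a i * r i = 1.
  apply: (mulIf gn0); rewrite mul1r -[RHS]ag mulr_suml.
  by apply: eq_bigr => i _; rewrite -mulrA -pr.
have rn0 t : exists i, (r i).[t] != 0.
  apply/existsP; apply: contraT => /existsPn h.
  have := congr1 (horner^~ t) ar; rewrite horner_sum big1 ?hornerC => [/eqP|i _].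
    by rewrite eq_sym oner_eq0.
  by rewrite hornerM; have /negPn/eqP -> := h i; rewrite mulr0.
pose d := (\max_i size (r i)).-1.
have sr i : (size (r i) <= d.+1)%N.
  apply: leq_trans (leqSpred _); exact: (leq_bigmax (F := fun i => size (r i)) i).
have [i1 ri1] : exists i, (r i)`_d != 0.
  have [|i1 hi1] := @eq_bigmax 'I_m (fun i => size (r i)).
    by rewrite card_ord; case: m i0 {hg gz0 p I Ip a ag gI r pr ar rn0 d sr} g => [[]|].
  exists i1; rewrite /d hi1 -/(lead_coef _) lead_coef_eq0.
  have [i ri] := rn0 0; rewrite -size_poly_gt0 -hi1.
  apply: leq_trans (leq_bigmax (F := fun i => size (r i)) i).
  by rewrite size_poly_gt0; apply: contraNneq ri => ->; rewrite horner0.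
have /choice[f hf] : forall i, exists F : {mpoly k[2]}, F \is d.-homog /\
    line_mpoly F (pt 1 0) (pt 0 1) = r i.
  by move=> i; have [F ? ?] := homogenization (sr i); exists F.
exists d, f; split=> [i|z [j zj]|z i j]; first by have [] := hf i.
  have [z00|zn0] := eqVneq (z ord0) 0.
    exists i1; rewrite (meval_eq _ (eq_pt z)) z00 (meval_pt0 _ (hf i1).1) (hf i1).2.
    rewrite mulf_neq0 // expf_neq0 //.
    move: zj; rewrite (eq_pt z j) /pt z00.
    by case: (j == ord0); rewrite ?eqxx.
  have [i ri] := rn0 (z ord_max / z ord0).
  exists i; rewrite (meval_eq _ (eq_pt z)) (meval_ptn0 _ (hf i).1) // (hf i).2.
  by rewrite mulf_neq0 // expf_neq0.
have rp : r i * p j = r j * p i by rewrite !pr mulrCA.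
have e F : F.@[z] = F.@[pt (z ord0) (z ord_max)] by apply/meval_eq/eq_pt.
rewrite !e; have [z00|zn0] := eqVneq (z ord0) 0.
  (* At infinity the claim compares the coefficients of degree [d + D] in
     [r i * p j = r j * p i]. *)
  rewrite z00 !(meval_pt0 _ (hf _).1) !(hf _).2 !(meval_pt0 _ (hg _)) -!/(p _).
  have tp l : has_top D (p l)`_D (p l).
    by have [] := line_mpoly_top (pt 1 0) (pt 0 1) (hg l).
  have rt l : has_top d (r l)`_d (r l) by [].
  rewrite mulrACA [RHS]mulrACA; congr (_ * _).
  have [_ <-] := has_topM (rt i) (tp j); have [_ <-] := has_topM (rt j) (tp i).
  by rewrite rp.
rewrite !(meval_ptn0 _ (hf _).1) // !(hf _).2 !(meval_ptn0 _ (hg _)) // -!/(p _).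
by rewrite mulrACA [RHS]mulrACA -!hornerM rp.
Qed.

(* Kronecker substitution: [h(t, t^N)] has no zero except [t = 0], hence is a
   monomial, and so is [h]. *)
Lemma mpoly2_unit (h : {mpoly k[2]}) :
  (forall z, (exists j, z j != 0) -> h.@[z] != 0) -> h \is a GRing.unit.
Proof.
move=> hn0; pose N := msize h.
(* All exponents in [h] are below [N], so [code] is an expansion in base [N] and injective on the
   support. *)
pose code (m : 'X_{1..2}) := (m ord0 + N * m ord_max)%N.
pose K := \sum_(m <- msupp h) (h@_m)%:P * 'X^(code m).
have KE t : K.[t] = h.@[pt t (t ^+ N)].
  rewrite mevalE horner_sum; apply: eq_bigr => m _.
  rewrite hornerM hornerC hornerXn big_ord_recl big_ord1 /pt /=.
  by rewrite exprD exprM; congr (_ * (_ * _ ^+ m _)); apply: val_inj.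
have mN m (i : 'I_2) : m \in msupp h -> (m i < N)%N.
  move/msize_mdeg_lt; apply: leq_ltn_trans.
  by rewrite mdegE (bigD1 i) //= leq_addr.
have code_inj m m' : m \in msupp h -> m' \in msupp h -> code m = code m' -> m = m'.
  move=> ms ms' cc.
  have N0 : (0 < N)%N by apply: leq_ltn_trans (mN _ ord0 ms).
  have e0 : m ord0 = m' ord0.
    have := congr1 (modn^~ N) cc; rewrite /code addnC mulnC modnMDl.
    by rewrite [in RHS]addnC [in RHS]mulnC modnMDl !modn_small // mN.
  have e1 : m ord_max = m' ord_max.
    by move/eqP: cc; rewrite /code e0 eqn_add2l eqn_pmul2l // => /eqP.
  apply/mnmP => i; case: i => -[|[|]] //= hi.
    by rewrite (_ : Ordinal hi = ord0) //; apply: val_inj.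
  by rewrite (_ : Ordinal hi = ord_max) //; apply: val_inj.
have Kcoef m : m \in msupp h -> K`_(code m) = h@_m.
  move=> ms; rewrite coef_sum (bigD1_seq m) ?msupp_uniq //= coefCM coefXn eqxx mulr1.
  rewrite big_seq_cond big1 ?addr0 // => m' /andP[ms' nm].
  rewrite coefCM coefXn; case: eqP => [/(code_inj _ _ ms ms') e|_]; last by rewrite mulr0.
  by rewrite e eqxx in nm.
have Kn0 t : t != 0 -> K.[t] != 0.
  by move=> tn0; rewrite KE; apply: hn0; exists ord0; rewrite /pt.
have KN0 : K != 0.
  by apply: contraNneq (Kn0 1 (oner_neq0 _)) => ->; rewrite horner0.
have [r [q qr Kq]] := multiplicity_XsubC K 0; rewrite KN0 subr0 /= in qr Kq.
have /eqP/size_poly1P[c cn0 qc] : size q = 1.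
  apply/eqP; apply/negPn/negP => /closed_rootP[t qt].
  have [t0|tn0] := eqVneq t 0; first by rewrite t0 (negbTE qr) in qt.
  by have := Kn0 _ tn0; rewrite Kq hornerM (rootP qt) mul0r eqxx.
have supp_r m : m \in msupp h -> code m = r.
  move=> ms; have := Kcoef _ ms; rewrite Kq qc coefCM coefXn; case: eqP => // _.
  by rewrite mulr0 => /esym/eqP; rewrite mcoeff_eq0 ms.
have hN0 : h != 0.
  apply: contraNneq (hn0 (fun=> 1) _) => [->|]; first by rewrite meval0.
  by exists ord0; rewrite oner_neq0.
have lms : mlead h \in msupp h by rewrite mlead_supp.
have sE : msupp h = [:: mlead h].
  apply/perm_small_eq => //; apply: uniq_perm; rewrite ?msupp_uniq //.
  move=> m; rewrite inE; apply/idP/eqP => [ms|->//].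
  by apply: code_inj => //; rewrite !supp_r.
have hE z : h.@[z] = h@_(mlead h) * \prod_i z i ^+ mlead h i.
  by rewrite mevalE sE big_seq1.
(* With a positive exponent at [i], the monomial would vanish at the nonzero point whose coordinate
   [i] is 0 and whose other coordinate is 1. *)
have l0 : mlead h = 0%MM.
  apply/mnmP => i; rewrite mnm0E; apply/eqP; apply/negPn/negP => li.
  have := hn0 (fun j => (j != i)%:R) _; rewrite hE (bigD1 i) //= eqxx expr0n (negbTE li).
  rewrite mul0r mulr0 eqxx => /(_ _)/negP[] //; exists (lift i ord0).
  by rewrite [lift i ord0 == i]eq_sym neq_lift oner_neq0.
have h0 : h@_0 != 0 by rewrite -mcoeff_msupp -l0.
have -> : h = (h@_0)%:MP.
  apply/mpolyP => m; rewrite mcoeffC; case: eqP => [<-|mn0]; first by rewrite mulr1.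
  rewrite mulr0; apply/eqP; rewrite mcoeff_eq0 sE inE l0.
  by apply/eqP => m0; apply: mn0.
apply/unitrP; exists ((h@_0)^-1)%:MP.
by rewrite -!mpolyCM mulVf // mulfV.
Qed.

End Restriction.

(** * Local representation of morphisms by forms *)

Section Lines.
Variables (k : fieldType) (V : vectType k).

Lemma proj_lineE (L : proj_space V) x : x \in (L : {vspace V}) -> x != 0 ->
  (L : {vspace V}) = <[x]>%VS.
Proof.
move=> xL x0; apply/esym/eqP.
by rewrite eqEdim -memvE xL (eqP (proj_dim L)) dim_vline x0.
Qed.

Lemma proj_pick (L : proj_space V) :
  (vpick (L : {vspace V}) \in (L : {vspace V})) /\ vpick (L : {vspace V}) != 0.
Proof. by split; rewrite ?memv_pick // vpick0 -dimv_eq0 (eqP (proj_dim L)). Qed.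

Lemma linear_form_homog (l : V -> k) : linear_for *%R l ->
  exists2 F : {mpoly k[\dim (@fullv k V)]}, F \is 1.-homog &
    forall x, l x = peval F x.
Proof.
move=> hl.
pose lM := GRing.isLinear.Build _ _ _ _ l hl.
pose l' : {linear V -> k | *%R} := HB.pack l lM.
exists (\sum_(i < \dim (@fullv k V)) l (vbasis fullv)`_i *: 'X_i).
  by apply: rpred_sum => i _; apply: dhomogZ; rewrite dhomogX /= mdeg1.
move=> x; rewrite /peval raddf_sum /= {1}(coord_vbasis (memvf x)) -[l]/(l' : V -> k).
rewrite linear_sum; apply: eq_bigr => i _.
by rewrite linearZ /= mevalZ mevalXU mulrC.
Qed.

Lemma polyfun_linear (l : V -> k) : linear_for *%R l -> polyfun l.
Proof. by move=> /linear_form_homog[F _ hF]; exists F. Qed.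

Lemma polyfun_coord n (X : n.-tuple V) i : polyfun (coord X i).
Proof. by apply: polyfun_linear => a x y; rewrite linearP. Qed.

Lemma polyfun_peval (W : {vspace V}) (F : {mpoly k[\dim W]}) : polyfun (peval F).
Proof. by apply: (polyfun_meval F) => i; apply: polyfun_coord. Qed.

Lemma coord_neq0 (x : V) : x != 0 -> exists i, coord (vbasis (@fullv k V)) i x != 0.
Proof.
move=> x0; apply/existsP; apply: contraNT x0 => /existsPn h.
rewrite (coord_vbasis (memvf x)) big1 // => i _.
by have /negPn/eqP -> := h i; rewrite scale0r.
Qed.

(** [u] is a form that defines a basic neighborhood of [L], times a coordinate nonzero on [L]; the
    coordinate makes [u] vanish at 0 even if the form is constant. *)
Lemma open_principal (O : set (proj_space V)) (L : proj_space V) : open O -> O L ->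
  exists u : V -> k, [/\ polyfun u,
    forall x, x \in (L : {vspace V}) -> x != 0 -> u x != 0 &
    forall (M : proj_space V) x, x \in (M : {vspace V}) -> u x != 0 -> x != 0 /\ O M].
Proof.
move=> [S hS ->].
move=> /existsNP[F /not_implyP[SF /existsNP[x0 /not_implyP[x0L /eqP Fx0]]]].
have [d hF] := hS _ SF.
have [zL z0] := proj_pick L; have [i zi] := coord_neq0 z0.
exists (fun x => peval F x * coord (vbasis fullv) i x); split.
- by apply: polyfunM; [apply: polyfun_peval | apply: polyfun_coord].
- move=> x xL xn0; apply: mulf_neq0.
    have [a e] := line_scale xL x0L xn0; move: Fx0.
    by rewrite e (pevalZ _ _ hF) mulf_eq0 negb_or => /andP[].
  have [a e] := line_scale xL zL xn0; move: zi.
  by rewrite e linearZ /= mulf_eq0 negb_or => /andP[].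
- move=> M x xM; rewrite mulf_eq0 negb_or => /andP[Fx xi]; split.
    by apply: contraNneq xi => ->; rewrite linear0.
  by move=> zM; move: Fx; rewrite (zM F SF x xM) eqxx.
Qed.

Lemma dhomog_bigprod n I (r : seq I) (P : pred I) (d : I -> nat)
    (H : I -> {mpoly k[n]}) : (forall i, H i \is (d i).-homog) ->
  \prod_(i <- r | P i) H i \is (\sum_(i <- r | P i) d i).-homog.
Proof.
move=> hH; elim/big_rec2: _ => [|i e p _ IH]; first exact: dhomog1.
exact: dhomogM.
Qed.

End Lines.

Section Wedge.
Variables (k : fieldType) (m : nat).
Implicit Types a b : 'rV[k]_m.

Lemma vline_wedge a b : <[a]>%VS = <[b]>%VS ->
  forall i j, a ord0 i * b ord0 j = a ord0 j * b ord0 i.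
Proof.
move=> ab i j; have /vlineP[c ->] : a \in <[b]>%VS by rewrite -ab memv_line.
by rewrite !mxE mulrAC.
Qed.

Lemma wedge_vline a b : a != 0 -> b != 0 ->
  (forall i j, a ord0 i * b ord0 j = a ord0 j * b ord0 i) -> <[a]>%VS = <[b]>%VS.
Proof.
move=> an0 /rV0Pn[j bj] w; apply/eqP; rewrite eqEdim !dim_vline an0.
rewrite (_ : b != 0) ?andbT; last by apply/rV0Pn; exists j.
rewrite -memvE; apply/vlineP; exists (a ord0 j / b ord0 j).
apply/rowP => i; rewrite !mxE mulrAC -w mulfK //.
Qed.

End Wedge.

Section LocalRepresentation.
Variables (k : fieldType) (V : vectType k) (m : nat).
Variables (A : set (proj_space V)) (phi : proj_space V -> proj_space 'rV[k]_m.+1).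

Definition prow (W : {vspace V}) (G : 'I_m.+1 -> {mpoly k[\dim W]}) (x : V) :=
  \row_i peval (G i) x.

(** Neighborhoods are loci [u x != 0] in the vector space, so that intersecting them amounts to
    multiplying polynomial functions. *)
Definition local_rep (u : V -> k) (D : nat)
    (G : 'I_m.+1 -> {mpoly k[\dim (@fullv k V)]}) :=
  [/\ polyfun u, forall i, G i \is D.-homog &
   forall (M : proj_space V) x, A M -> x \in (M : {vspace V}) -> u x != 0 ->
     x != 0 /\ (phi M : {vspace 'rV[k]_m.+1}) = <[prow G x]>%VS].

(** Where the coordinate [a] is nonzero, the functions [y_b / y_a] are regular, so their pullbacks
    are fractions of forms near [L]; the [G b] arise by clearing denominators. *)
Lemma local_rep_exists (L : proj_space V) : morphism_on A phi -> A L ->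
  exists u D G, local_rep u D G /\
    forall x, x \in (L : {vspace V}) -> x != 0 -> u x != 0.
Proof.
move=> [phic phir] AL.
have lin b : linear_for *%R (fun y : 'rV[k]_m.+1 => y ord0 b).
  by move=> c x y; rewrite !mxE.
have /choice[F hF] : forall b : 'I_m.+1,
    exists F : {mpoly k[\dim (@fullv k 'rV[k]_m.+1)]}, F \is 1.-homog /\
    forall y : 'rV[k]_m.+1, y ord0 b = peval F y.
  by move=> b; have [F h1 h2] := linear_form_homog (lin b); exists F.
have [wL wn0] := proj_pick (phi L).
have [a wa] : exists a, vpick (phi L : {vspace 'rV[k]_m.+1}) ord0 a != 0.
  by have /rV0Pn := wn0.
pose Oa : set (proj_space 'rV[k]_m.+1) := ~` zero_locus [set F a].
have Oa_open : open Oa.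
  by exists [set F a] => // _ ->; exists 1; have [] := hF a.
have OaP M y : Oa M -> y \in (M : {vspace 'rV[k]_m.+1}) -> y != 0 -> y ord0 a != 0.
  move=> OM yM yn0; apply: contra_notN OM => /eqP ya _ -> z zM.
  by have [c ->] := line_scale yM zM yn0; rewrite -(hF a).2 mxE ya mulr0.
have OaL : Oa (phi L).
  by move=> /(_ _ erefl _ wL) /eqP; rewrite -(hF a).2; apply/negP.
pose q b (M : proj_space 'rV[k]_m.+1) :=
  let y := vpick (M : {vspace 'rV[k]_m.+1}) in y ord0 b / y ord0 a.
have q_reg b : regular_function Oa (q b).
  move=> M OM; exists Oa; split=> //; exists 1, (F b), (F a).
  split; [by have [] := hF b | by have [] := hF a |].
  move=> N ON _ x xN xn0; have xa := OaP _ _ ON xN xn0.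
  rewrite -(hF a).2 -(hF b).2; split=> //; rewrite /q.
  have [zN zn0] := proj_pick N; have [c e] := line_scale xN zN xn0.
  have cn0 : c != 0 by apply: contraNneq zn0 => c0; rewrite e c0 scale0r.
  by rewrite e !mxE -mulf_div divff // mul1r.
have /choice[R hR] : forall b : 'I_m.+1, exists R : (V -> k) * nat *
    ({mpoly k[\dim (@fullv k V)]} * {mpoly k[\dim (@fullv k V)]}),
    [/\ polyfun R.1.1, forall x, x \in (L : {vspace V}) -> x != 0 -> R.1.1 x != 0,
        R.2.1 \is R.1.2.-homog, R.2.2 \is R.1.2.-homog &
        forall (M : proj_space V) x, A M -> Oa (phi M) -> x \in (M : {vspace V}) ->
          R.1.1 x != 0 -> [/\ x != 0, peval R.2.2 x != 0 &
          q b (phi M) = peval R.2.1 x / peval R.2.2 x]].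
  move=> b; have [O [oO OL [d [G [H [hG hH h]]]]]] := phir _ _ Oa_open (q_reg b) L (conj AL OaL).
  have [u [pu uL uO]] := open_principal oO OL.
  exists ((u, d), (G, H)); split=> //= M x AM OM xM ux.
  have [xn0 OM'] := uO _ _ xM ux.
  by have [] := h M OM' (conj AM OM) x xM xn0.
(* The fractions describe [phi] only on lines sent into [Oa]; by continuity these include all lines
   of [A] near [L]. *)
have [W oW WA] : exists2 W : set (proj_space V), open W & W `&` A = phi @^-1` Oa `&` A.
  by apply/open_subspaceP; move/continuousP: phic; apply.
have [uW [puW uWL uWO]] : exists u : V -> k, [/\ polyfun u,
    forall x, x \in (L : {vspace V}) -> x != 0 -> u x != 0 &
    forall (M : proj_space V) x, x \in (M : {vspace V}) -> u x != 0 -> x != 0 /\ W M].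
  apply: open_principal => //.
  by have [] : (W `&` A) L by rewrite WA; split.
pose H b := (R b).2.2; pose d b := (R b).1.2.
(* Multiplying by the other denominators gives all [G b] the common degree [\sum_b d b]. *)
pose G b := (R b).2.1 * \prod_(c | c != b) H c.
exists (fun x => uW x * \prod_b (R b).1.1 x), (\sum_b d b)%N, G; split; last first.
  move=> x xL xn0; rewrite mulf_neq0 ?uWL //; apply/prodf_neq0 => b _.
  by have [_ h _ _ _] := hR b; apply: (h x).
split.
- by apply: polyfunM => //; apply: polyfun_prod => b; have [] := hR b.
- move=> b; rewrite (bigD1 b) //=; apply: dhomogM; first by have [] := hR b.
  by apply: dhomog_bigprod => c; have [] := hR c.
move=> M x AM xM; rewrite mulf_eq0 negb_or => /andP[uWx /prodf_neq0 ux].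
have [xn0 WM] := uWO _ _ xM uWx; split=> //.
have OM : Oa (phi M) by have [] : (phi @^-1` Oa `&` A) M by rewrite -WA.
have Hq b : peval (H b) x != 0 /\ q b (phi M) = peval (R b).2.1 x / peval (H b) x.
  by have [_ _ _ _ h] := hR b; have [] := h M x AM OM xM (ux b isT).
have [yM yn0] := proj_pick (phi M).
rewrite (proj_lineE yM yn0).
set y := vpick _ in yM yn0 *; have ya := OaP _ _ OM yM yn0.
pose Hx := \prod_b peval (H b) x.
have Hxn0 : Hx != 0 by apply/prodf_neq0 => b _; have [] := Hq b.
have -> : prow G x = (Hx / y ord0 a) *: y.
  apply/rowP => b; rewrite !mxE /G {1}/peval mevalM rmorph_prod /=.
  rewrite mulrAC -mulrA -/(q b (phi M)) (Hq b).2 /Hx [in RHS](bigD1 b) //=.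
  by rewrite [RHS]mulrC mulrA divfK //; have [] := Hq b.
have cn0 : Hx / y ord0 a != 0 by rewrite mulf_neq0 // invr_eq0.
apply/eqP; rewrite eqEsubv -!memvE memvZ ?memv_line // andbT.
by apply/vlineP; exists (Hx / y ord0 a)^-1; rewrite scalerA mulVf // scale1r.
Qed.

End LocalRepresentation.

(** * Restriction to lines and planes *)

Section LinePoly.
Variables (k : closedFieldType) (V : vectType k).

Definition line_poly (W : {vspace V}) (F : {mpoly k[\dim W]}) (x y : V) : {poly k} :=
  line_mpoly F (fun i => coord (vbasis W) i x) (fun i => coord (vbasis W) i y).

Lemma horner_line_poly (W : {vspace V}) (F : {mpoly k[\dim W]}) x y t :
  (line_poly F x y).[t] = peval F (x + t *: y).
Proof.
by rewrite horner_line_mpoly; apply: meval_eq => i; rewrite linearD linearZ.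
Qed.

Lemma line_poly_top (W : {vspace V}) (F : {mpoly k[\dim W]}) d x y :
  F \is d.-homog -> has_top d (peval F y) (line_poly F x y).
Proof. exact: line_mpoly_top. Qed.

Lemma polyfun_comp (T : vectType k) (e : T -> V) (f : V -> k) :
  linear e -> polyfun f -> polyfun (fun B => f (e B)).
Proof.
move=> le [F hF]; apply: (@eq_polyfun _ _ (fun B => peval F (e B))) => [B|].
  by rewrite hF.
apply: (polyfun_meval F) => i; apply: polyfun_linear => a x y.
by rewrite le linearP.
Qed.

Lemma polyfam_line (T : vectType k) (e1 e2 : T -> V)
    (F : {mpoly k[\dim (@fullv k V)]}) : linear e1 -> linear e2 ->
  polyfam (fun B => line_poly F (e1 B) (e2 B)).
Proof.
move=> l1 l2.
have lin (e : T -> V) i : linear e -> polyfam (fun B => (coord (vbasis fullv) i (e B))%:P).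
  move=> le; split=> [|j]; first by exists 1 => B; apply: size_polyC_leq1.
  have pe : polyfun (fun B => coord (vbasis fullv) i (e B)).
    exact: (polyfun_comp le (polyfun_coord _ i)).
  case: j => [|j]; first by apply: eq_polyfun pe => B; rewrite coefC.
  by apply: eq_polyfun (polyfunC _ 0) => B; rewrite coefC.
apply: polyfam_sum => n; apply: polyfamM; first exact: polyfamC.
apply: polyfam_prod => i.
have pX j : polyfam (fun B => ((coord (vbasis fullv) i (e1 B))%:P +
    (coord (vbasis fullv) i (e2 B))%:P * 'X) ^+ j).
  elim: j => [|j IH]; first exact: polyfamC.
  have -> : (fun B => ((coord (vbasis fullv) i (e1 B))%:P +
    (coord (vbasis fullv) i (e2 B))%:P * 'X) ^+ j.+1) = fun B =>
     ((coord (vbasis fullv) i (e1 B))%:P + (coord (vbasis fullv) i (e2 B))%:P * 'X) *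
     ((coord (vbasis fullv) i (e1 B))%:P + (coord (vbasis fullv) i (e2 B))%:P * 'X) ^+ j.
    by apply/funext => B; rewrite exprS.
  apply: polyfamM => //; apply: polyfamD; first exact: lin.
  by apply: polyfamM (lin _ _ l2) _; apply: polyfamC.
exact: pX.
Qed.

(* Restriction to a line reduces this to the ring of polynomials in one variable
   being a domain. *)
Lemma polyfun_domain (W : {vspace V}) (f u : V -> k) y :
  polyfun f -> polyfun u -> (forall x, x \in W -> f x * u x = 0) ->
  y \in W -> u y != 0 -> forall x, x \in W -> f x = 0.
Proof.
move=> [F hF] [U hU] fu yW uy x xW.
have fuE : line_poly F y (x - y) * line_poly U y (x - y) = 0.
  apply: poly_eq_horner => t; rewrite hornerM !horner_line_poly -hF -hU horner0.
  by apply: fu; rewrite rpredD // rpredZ // rpredB.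
have Un0 : line_poly U y (x - y) != 0.
  apply: contraNneq uy => U0; have := horner_line_poly U y (x - y) 0.
  by rewrite U0 horner0 scale0r addr0 -hU => <-.
have F0 : line_poly F y (x - y) = 0.
  by apply/eqP; move/eqP: fuE; rewrite mulf_eq0 (negbTE Un0) orbF.
have := horner_line_poly F y (x - y) 1.
by rewrite F0 horner0 scale1r addrC subrK -hF => <-.
Qed.

Lemma polyfunN (f : V -> k) : polyfun f -> polyfun (fun x => - f x).
Proof.
move=> hf; apply: (@eq_polyfun _ _ (fun x => -1 * f x)) => [x|].
  by rewrite mulN1r.
by apply: polyfunM => //; apply: polyfunC.
Qed.

(** The minors multiplied by [u] vanish on all of [W], and polynomial functions on [W] form a
    domain. *)
Lemma wedge_on (W : {vspace V}) m (g h : 'I_m -> V -> k) (u : V -> k) y :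
  polyfun u -> (forall i, polyfun (g i)) -> (forall i, polyfun (h i)) ->
  (forall x, x \in W -> u x != 0 ->
     <[\row_i g i x]>%VS = <[\row_i h i x]>%VS :> {vspace 'rV[k]_m}) ->
  y \in W -> u y != 0 ->
  forall x i j, x \in W -> g i x * h j x = g j x * h i x.
Proof.
move=> pu pg ph gh yW uy x i j xW; apply/eqP; rewrite -subr_eq0; apply/eqP.
move: x xW; apply: (@polyfun_domain W _ u y) => //.
  by apply: polyfunD; [|apply: polyfunN]; apply: polyfunM.
move=> x xW; have [->|ux] := eqVneq (u x) 0; first by rewrite mulr0.
by have := vline_wedge (gh x xW ux) i j; rewrite !mxE => ->; rewrite subrr mul0r.
Qed.

(** Homogenize the restriction to the line [e1 + t e2]; its coefficient of degree [D] is the value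
    at [e2], the point at infinity. *)
Lemma plane_form (G : {mpoly k[\dim (@fullv k V)]}) D (e1 e2 : V) : G \is D.-homog ->
  exists2 g : {mpoly k[2]}, g \is D.-homog &
    forall z, g.@[z] = peval G (z ord0 *: e1 + z ord_max *: e2).
Proof.
move=> hG; have [sG tG] := line_poly_top e1 e2 hG.
have [g hg gE] := homogenization sG; exists g => // z.
rewrite (meval_eq _ (eq_pt z)).
have [->|z0] := eqVneq (z ord0) 0.
  by rewrite (meval_pt0 _ hg) gE tG scale0r add0r (pevalZ _ _ hG).
rewrite (meval_ptn0 _ hg) // gE horner_line_poly -(pevalZ _ _ hG) scalerDr scalerA.
by rewrite mulrCA divff // mulr1.
Qed.

(** A common divisor of the forms from [homog_reduce] has no zero except possibly 0, hence is a
    unit. The variable [n] allows the instance [\dim v], equal but not convertible to 2. *)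
Lemma plane_reduce n (e : 'I_n -> V) m D (G : 'I_m -> {mpoly k[\dim (@fullv k V)]}) :
  n = 2%N -> (forall i, G i \is D.-homog) ->
  (exists i (z : 'I_n -> k), peval (G i) (\sum_j z j *: e j) != 0) ->
  exists d (f : 'I_m -> {mpoly k[n]}),
    [/\ forall i, f i \is d.-homog, poly_gcd_is_one f,
        forall z, (exists j, z j != 0) -> exists i, (f i).@[z] != 0 &
        forall z i j, (f i).@[z] * peval (G j) (\sum_l z l *: e l) =
                      (f j).@[z] * peval (G i) (\sum_l z l *: e l)].
Proof.
move=> n2; subst n => hG [i0 [z0 Gz0]].
have sumE (z : 'I_2 -> k) : \sum_l z l *: e l = z ord0 *: e ord0 + z ord_max *: e ord_max.
  rewrite big_ord_recl big_ord1; congr (_ + _).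
  by rewrite (_ : lift _ _ = ord_max) //; apply: val_inj.
have /choice[g hg] : forall i, exists g : {mpoly k[2]}, g \is D.-homog /\
    forall z, g.@[z] = peval (G i) (z ord0 *: e ord0 + z ord_max *: e ord_max).
  by move=> i; have [g ? ?] := plane_form (e ord0) (e ord_max) (hG i); exists g.
have [|d [f [hf fn0 fg]]] := homog_reduce (fun i => (hg i).1).
  by exists i0, z0; rewrite (hg i0).2 -sumE.
exists d, f; split=> // [h hdvd|z i j].
  apply: mpoly2_unit => z /fn0[i]; have [q ->] := hdvd i.
  by rewrite mevalM mulf_eq0 negb_or => /andP[].
by rewrite sumE -!(hg _).2.
Qed.

End LinePoly.

(** * The degree on the planes of a family *)

Section Degree.
Variables (k : closedFieldType) (V : vectType k) (m : nat).
Variables (A : set (proj_space V)) (phi : proj_space V -> proj_space 'rV[k]_m.+1).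
Hypothesis phi_morph : morphism_on A phi.

Let line_through (x : V) : x != 0 -> exists M : proj_space V, (M : {vspace V}) = <[x]>%VS.
Proof.
move=> x0; have dx : \dim <[x]>%VS == 1%N by rewrite dim_vline x0.
by exists (Proj dx).
Qed.

Lemma phi_row_neq0 (M : proj_space V) (r : 'rV[k]_m.+1) :
  (phi M : {vspace 'rV[k]_m.+1}) = <[r]>%VS -> r != 0.
Proof.
move=> e; have := proj_dim (phi M); rewrite e dim_vline.
by case: (r != 0).
Qed.

Let prow_neq0 (W : {vspace V}) (G : 'I_m.+1 -> {mpoly k[\dim W]}) x :
  prow G x != 0 -> exists i, peval (G i) x != 0.
Proof. by move=> /rV0Pn[i]; rewrite mxE; exists i. Qed.

Definition degree_form (W : {vspace V}) (d : nat) (f : 'I_m.+1 -> {mpoly k[\dim W]}) :=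
  (forall i, f i \is d.-homog) /\
  forall L : proj_space V, (L <= W)%VS -> forall x, x \in (L : {vspace V}) -> x != 0 ->
    (phi L : {vspace 'rV[k]_m.+1}) = <[prow f x]>%VS.

Lemma degree_form_neq0 (W : {vspace V}) d (f : 'I_m.+1 -> {mpoly k[\dim W]}) x :
  degree_form d f -> x \in W -> x != 0 -> exists i, peval (f i) x != 0.
Proof.
move=> [_ hf] xW x0; apply: prow_neq0; have [M ME] := line_through x0.
apply: (@phi_row_neq0 M); apply: hf => //; first by rewrite ME -memvE.
by rewrite ME memv_line.
Qed.

Lemma local_rep_neq0 u D G (x : V) : local_rep A phi u D G ->
  (forall M : proj_space V, (M <= <[x]>)%VS -> A M) -> u x != 0 ->
  x != 0 -> exists i, peval (G i) x != 0.
Proof.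
move=> [_ _ hG] AM ux x0; apply: prow_neq0; have [M ME] := line_through x0.
apply: (@phi_row_neq0 M); have [] // := hG M x _ _ ux.
  by apply: AM; rewrite ME.
by rewrite ME memv_line.
Qed.

Section Plane.
Variable v : gr2 V.
Hypothesis Av : forall M : proj_space V, (M <= v)%VS -> A M.

Let A_sub x : x \in (v : {vspace V}) -> forall M : proj_space V, (M <= <[x]>)%VS -> A M.
Proof. by move=> xv M Mx; apply: Av; apply: subv_trans Mx _; rewrite -memvE. Qed.

Let local_rep_line u D G x : local_rep A phi u D G -> x \in (v : {vspace V}) ->
  u x != 0 -> forall M : proj_space V, (M : {vspace V}) = <[x]>%VS ->
  (phi M : {vspace 'rV[k]_m.+1}) = <[prow G x]>%VS.
Proof.
move=> [_ _ hG] xv ux M ME; have [] // := hG M x _ _ ux.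
  by apply: (A_sub xv); rewrite ME.
by rewrite ME memv_line.
Qed.

Lemma rep_at x : x \in (v : {vspace V}) -> x != 0 ->
  exists u D G, local_rep A phi u D G /\ u x != 0.
Proof.
move=> xv x0; have [M ME] := line_through x0.
have AM : A M by apply: (A_sub xv); rewrite ME.
have [u [D [G [hG hu]]]] := local_rep_exists phi_morph AM.
by exists u, D, G; split=> //; apply: hu; rewrite // ME memv_line.
Qed.

Let local_rep_n0 u D G x : local_rep A phi u D G -> x \in (v : {vspace V}) ->
  u x != 0 -> x != 0.
Proof.
(* Local representations speak of lines, so even [x = 0] is first placed on a line of [v]. *)
move=> [_ _ hG] xv ux; have [z [zv z0 xz]] : exists z, [/\ z \in (v : {vspace V}), z != 0 &
    x \in <[z]>%VS].
  have [->|x0] := eqVneq x 0; last by exists x; rewrite memv_line.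
  exists (vpick (v : {vspace V})); rewrite memv_pick vpick0 mem0v; split=> //.
  by rewrite -dimv_eq0 (eqP (gr2_dim v)).
have [M ME] := line_through z0.
have [] // := hG M x _ _ ux; last by rewrite ME.
by apply: (A_sub zv); rewrite ME.
Qed.

(** Reduce one local representation [G] to coprime forms [f], and take a representation [G'] at any
    other point [x]. On [v], [f] is proportional to [G] by construction and [G] to [G'] because
    their domains meet; cancelling the nonzero [G a] makes [f] proportional to [G'] at [x]. *)
Lemma is_degree_exists : exists d, is_degree v phi d.
Proof.
pose x0 := vpick (v : {vspace V}).
have xv : x0 \in (v : {vspace V}) by rewrite memv_pick.
have xn0 : x0 != 0 by rewrite vpick0 -dimv_eq0 (eqP (gr2_dim v)).
have [u [D [G [hG ux]]]] := rep_at xv xn0; have [pu homG repG] := hG.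
have [a Ga] := local_rep_neq0 hG (A_sub xv) ux xn0.
pose e j := (vbasis (v : {vspace V}))`_j.
have eE x : x \in (v : {vspace V}) ->
    x = \sum_(j < \dim v) coord (vbasis v) j x *: e j.
  by move=> /coord_vbasis.
have [|d [f [hf fgcd fn0 fG]]] := @plane_reduce k V (\dim v) e m.+1 D G (eqP (gr2_dim v)) homG.
  by exists a, (fun j => coord (vbasis v) j x0); rewrite -eE.
exists d, f; split=> // L Lv x xL xn.
have xv' : x \in (v : {vspace V}) by apply: subvP Lv _ xL.
have [u' [D' [G' [hG' ux']]]] := rep_at xv' xn; have [pu' homG' _] := hG'.
have LE : (L : {vspace V}) = <[x]>%VS by apply: proj_lineE.
rewrite (local_rep_line hG' xv' ux' LE); apply/esym.
have [y [yv uy]] : exists y, y \in (v : {vspace V}) /\ u y * u' y != 0.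
  apply: contrapT => h; move/eqP: ux; apply.
  have uu z : z \in (v : {vspace V}) -> u z * u' z = 0.
    by move=> zv; apply: contrapT => /eqP uz; apply: h; exists z.
  exact: (polyfun_domain pu pu' uu xv' ux' xv).
have GG' : forall z i j, z \in (v : {vspace V}) ->
    peval (G i) z * peval (G' j) z = peval (G j) z * peval (G' i) z.
  move=> z i j zv; apply: (wedge_on (g := fun i => peval (G i))
    (h := fun i => peval (G' i)) (polyfunM pu pu') _ _ _ yv uy) => //.
  - by move=> ?; apply: polyfun_peval.
  - by move=> ?; apply: polyfun_peval.
  move=> {z zv}z zv; rewrite mulf_eq0 negb_or => /andP[uz uz'].
  have [M ME] := line_through (local_rep_n0 hG zv uz).
  by rewrite -(local_rep_line hG zv uz ME) (local_rep_line hG' zv uz' ME).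
have fGv z i j : z \in (v : {vspace V}) ->
    peval (f i) z * peval (G j) z = peval (f j) z * peval (G i) z.
  by move=> zv; have := fG (fun l => coord (vbasis v) l z) i j; rewrite -eE.
have fG' i j : peval (f i) x * peval (G' j) x = peval (f j) x * peval (G' i) x.
  have h0 z : z \in (v : {vspace V}) ->
      (peval (f i) z * peval (G' j) z - peval (f j) z * peval (G' i) z) * peval (G a) z = 0.
    move=> zv; rewrite mulrBl mulrAC (fGv z i a zv) [X in _ - X]mulrAC (fGv z j a zv).
    by rewrite -!mulrA (GG' z i j zv) subrr.
  apply/eqP; rewrite -subr_eq0; apply/eqP.
  apply: (polyfun_domain _ (polyfun_peval (G a)) h0 xv Ga xv').
  by apply: polyfunD; [|apply: polyfunN]; apply: polyfunM; apply: polyfun_peval.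
apply: wedge_vline.
- have [i fi] : exists i, (f i).@[fun l => coord (vbasis v) l x] != 0.
    apply: fn0; apply/existsP; apply: contraNT xn => /existsPn h.
    by rewrite (eE _ xv') big1 // => j _; have /negPn/eqP -> := h j; rewrite scale0r.
  by apply/rV0Pn; exists i; rewrite mxE.
- by apply: (@phi_row_neq0 L); apply: local_rep_line hG' xv' ux' L LE.
- by move=> i j; rewrite !mxE.
Qed.

(** The [f b] have no common zero on the line, so some combination with coefficients [a i] is 1; the
    same combination of the [G i] is [h], by proportionality. The domain of [G] need only meet the
    plane, so [h] may vanish on the line. *)
Lemma local_rep_factor d (f : 'I_m.+1 -> {mpoly k[\dim v]}) u D G x y z :
  degree_form d f -> local_rep A phi u D G ->
  z \in (v : {vspace V}) -> u z != 0 ->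
  x \in (v : {vspace V}) -> y \in (v : {vspace V}) ->
  (forall t, x + t *: y != 0) ->
  exists h, forall b, line_poly (G b) x y = h * line_poly (f b) x y.
Proof.
move=> hf hG zv uz xv yv xy; have [pu _ _] := hG.
have xtyv t : x + t *: y \in (v : {vspace V}) by rewrite rpredD // rpredZ.
have fG : forall z i j, z \in (v : {vspace V}) ->
    peval (f i) z * peval (G j) z = peval (f j) z * peval (G i) z.
  move=> w i j wv; apply: (wedge_on (g := fun i => peval (f i))
    (h := fun i => peval (G i)) pu _ _ _ zv uz) => //.
  - by move=> ?; apply: polyfun_peval.
  - by move=> ?; apply: polyfun_peval.
  move=> {w wv}w wv uw; have wn0 := local_rep_n0 hG wv uw.
  have [M ME] := line_through wn0.
  rewrite -/(prow G w) -(local_rep_line hG wv uw ME); apply/esym/hf.2 => //.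
    by rewrite ME -memvE.
  by rewrite ME memv_line.
have [|a aE] := bezout_family (f := fun i => line_poly (f i) x y).
  move=> t; have [i fi] := degree_form_neq0 hf (xtyv t) (xy t).
  by exists i; rewrite horner_line_poly.
exists (\sum_i a i * line_poly (G i) x y) => b.
rewrite -[LHS]mul1r -aE !mulr_suml; apply: eq_bigr => i _.
rewrite -!mulrA; congr (_ * _); apply: poly_eq_horner => t.
by rewrite !hornerM !horner_line_poly fG // mulrC.
Qed.

End Plane.

Section Family.
Variables (X : set (gr2 V)) (T : vectType k) (e1 e2 : T -> V).
Hypothesis XA : forall v, X v -> forall M : proj_space V, (M <= v)%VS -> A M.
Hypotheses (lin1 : linear e1) (lin2 : linear e2).

(** So [e1 B], [e2 B] form a basis of [v], and P([v]) is the affine line [e1 B + t *: e2 B] with the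
    point at infinity [e2 B]. *)
Definition parametrizes (B : T) (v : gr2 V) :=
  [/\ e1 B \in (v : {vspace V}), e2 B \in (v : {vspace V}), e2 B != 0 &
      forall t, e1 B + t *: e2 B != 0].

Lemma degree_constant_nearby (v0 : gr2 V) B0 d0 (f0 : 'I_m.+1 -> {mpoly k[\dim v0]}) :
  X v0 -> parametrizes B0 v0 -> degree_form d0 f0 ->
  exists delta : T -> k, [/\ polyfun delta, delta B0 != 0 &
    forall (v : gr2 V) B d (f : 'I_m.+1 -> {mpoly k[\dim v]}), X v -> parametrizes B v ->
      degree_form d f -> delta B != 0 -> d = d0].
Proof.
move=> Xv0 pB0 hf0; have [e1v0 e2v0 e2n0 e12n0] := pB0.
have [u [D [G [hG ue2]]]] := rep_at (XA Xv0) e2v0 e2n0.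
have [pu homG repG] := hG.
have [a Ga] : exists a, peval (G a) (e2 B0) != 0.
  apply: (local_rep_neq0 hG _ ue2 e2n0) => M Me2; apply: (XA Xv0).
  by apply: subv_trans Me2 _; rewrite -memvE.
pose ln (F : {mpoly k[\dim (@fullv k V)]}) B := line_poly F (e1 B) (e2 B).
(* At infinity [f] and [G] are proportional, so [f a] is nonzero there along with [G a]. Both
   restrictions then have full degree, [d] and [D], and [h] has degree [D - d]. *)
have factor (v : gr2 V) B d (f : 'I_m.+1 -> {mpoly k[\dim v]}) : X v -> parametrizes B v ->
    degree_form d f -> u (e2 B) != 0 -> peval (G a) (e2 B) != 0 ->
    exists h, [/\ forall b, ln (G b) B = h * line_poly (f b) (e1 B) (e2 B),
      (size h + d = D.+1)%N & size (line_poly (f a) (e1 B) (e2 B)) = d.+1].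
  move=> Xv [e1v e2v e2n e12n] hf ueB GaB.
  have [h hE] := local_rep_factor (XA Xv) hf hG e2v ueB e1v e2v e12n.
  have fa : peval (f a) (e2 B) != 0.
    have [j fj] := degree_form_neq0 hf e2v e2n.
    have [M ME] := line_through e2n.
    have AM : A M by apply: (XA Xv); rewrite ME -memvE.
    have xM : e2 B \in (M : {vspace V}) by rewrite ME memv_line.
    have [_ GE] := repG M (e2 B) AM xM ueB.
    have fE : (phi M : {vspace 'rV[k]_m.+1}) = <[prow f (e2 B)]>%VS.
      by apply: hf.2 => //; rewrite ME -memvE.
    have := vline_wedge (etrans (esym GE) fE) a j; rewrite !mxE => w.
    apply: contraNneq (mulf_neq0 GaB fj) => fa0.
    by rewrite w fa0 mulr0.
  have sz (W : {vspace V}) F e : F \is e.-homog -> peval F (e2 B) != 0 ->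
      size (@line_poly k V W F (e1 B) (e2 B)) = e.+1.
    move=> hF Fn0; have [sF tF] := line_poly_top (e1 B) (e2 B) hF.
    apply/eqP; rewrite eqn_leq sF /= ltnNge; apply/negP => sF'.
    by move: Fn0; rewrite -tF nth_default ?eqxx.
  have sG := sz _ _ _ (homG a) GaB; have sf := sz _ _ _ (hf.1 a) fa.
  exists h; split=> //.
  have hn0 : h != 0.
    by apply/eqP => h0; move: sG; rewrite hE h0 mul0r size_poly0.
  have fn0 : line_poly (f a) (e1 B) (e2 B) != 0 by rewrite -size_poly_gt0 sf.
  by have := size_mul hn0 fn0; rewrite -hE sG sf addnS /= => ->.
have [h0 [h0E sh0 sf0]] := factor v0 B0 d0 f0 Xv0 pB0 hf0 ue2 Ga.
have lnB0 t b : (line_poly (f0 b) (e1 B0) (e2 B0)).[t] = peval (f0 b) (e1 B0 + t *: e2 B0).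
  by rewrite horner_line_poly.
have e12v t : e1 B0 + t *: e2 B0 \in (v0 : {vspace V}) by rewrite rpredD // rpredZ.
(* These coefficients, found at [B0], are kept for every [B]; the combination [Q1] below thus equals
   [h0] at [B0] and is divisible by [h] nearby. *)
have [c cE] : exists c : 'I_m.+1 -> {poly k},
    \sum_i c i * line_poly (f0 i) (e1 B0) (e2 B0) = 1.
  apply: bezout_family => t.
  have [i fi] := degree_form_neq0 hf0 (e12v t) (e12n0 t).
  by exists i; rewrite lnB0.
have famln F : polyfam (ln F) by apply: polyfam_line.
have sln B : (size (ln (G a) B) <= D.+1)%N.
  by have [] := line_poly_top (e1 B) (e2 B) (homG a).
have lnD : (ln (G a) B0)`_D != 0.
  by have [_ ->] := line_poly_top (e1 B0) (e2 B0) (homG a).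
have h0n0 : h0 != 0.
  by apply: contraNneq lnD => h00; rewrite h0E h00 mul0r coef0.
(* Lower semicontinuity: the gcd of the components of [G] restricted to the plane
   has degree [D - d]. *)
pose Q1 B := \sum_b c b * ln (G b) B.
have Q1B0 : Q1 B0 = h0.
  rewrite /Q1 -[RHS]mulr1 -cE mulr_sumr; apply: eq_bigr => b _.
  by rewrite h0E mulrCA.
have [|||delta1 [pd1 d1B0 hd1]] :=
    common_divisor_semicontinuous (Q := Q1) (famln (G a)) _ sln lnD.
- by apply: polyfam_sum => b; apply: polyfamM => //; apply: polyfamC.
- by rewrite Q1B0.
- by rewrite Q1B0 -sh0 leq_addr.
(* Upper semicontinuity: [f_a] divides the components [G'_a] of all local
   representations, which at [v0] generate the ideal of [f0_a]. *)
pose f0a := line_poly (f0 a) (e1 B0) (e2 B0).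
pose I q := exists Q delta, [/\ polyfam Q, polyfun delta, delta B0 != 0, Q B0 = q * f0a &
  forall (v : gr2 V) B d (f : 'I_m.+1 -> {mpoly k[\dim v]}), X v -> parametrizes B v ->
    degree_form d f -> delta B != 0 -> line_poly (f a) (e1 B) (e2 B) %| Q B].
have [Q2 [delta2 [fQ2 pd2 d2B0 Q2B0 hd2]]] : I 1.
  apply: ideal_one => [p q r [Qp [dp [fp pp dpn pE hp]]] [Qq [dq [fq pq dqn qE hq]]]|t].
    exists (fun B => Qp B + r * Qq B), (fun B => dp B * dq B); split.
    - by apply: polyfamD => //; apply: polyfamM => //; apply: polyfamC.
    - exact: polyfunM.
    - exact: mulf_neq0.
    - by rewrite pE qE mulrDl mulrA.
    move=> v B d f Xv pB hf; rewrite mulf_eq0 negb_or => /andP[dpB dqB].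
    by rewrite dvdp_add ?dvdp_mull ?(hp v B d f) ?(hq v B d f).
  (* A representation at the point with parameter [t] gives an element of the ideal nonzero at [t]:
     if [h] vanished there, so would all [G']. *)
  have [u' [D' [G' [hG' ut]]]] := rep_at (XA Xv0) (e12v t) (e12n0 t).
  have [h hE] := local_rep_factor (XA Xv0) hf0 hG' (e12v t) ut e1v0 e2v0 e12n0.
  exists h.
    exists (ln (G' a)), (fun B => u' (e1 B + t *: e2 B)); split=> //.
    - apply: polyfun_comp; last by have [] := hG'.
      move=> s B B'; rewrite lin1 lin2 scalerDr addrACA scalerDr; congr (_ + _ + _).
      by rewrite !scalerA mulrC.
    - exact: hE.
    move=> v B d f Xv [e1v e2v _ e12n] hf uB.
    have [|h' h'E] := local_rep_factor (XA Xv) hf hG' _ uB e1v e2v e12n.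
      by rewrite rpredD // rpredZ.
    by rewrite /ln h'E dvdp_mull.
  have [|b Gb] := local_rep_neq0 hG' _ ut (e12n0 t).
    move=> M Me; apply: (XA Xv0); apply: subv_trans Me _.
    by rewrite -memvE.
  apply: contraNneq Gb => ht.
  by rewrite -horner_line_poly hE hornerM ht mul0r.
have f0an0 : f0a != 0 by rewrite -size_poly_gt0 sf0.
rewrite mul1r in Q2B0.
(* Near [B0], [f_a] divides both [G_a] and [Q2], and [Q2] is [f0a] at [B0]; [G_a] supplies the
   polynomial of full degree [D]. *)
have [||delta3 [pd3 d3B0 hd3]] :=
    common_divisor_semicontinuous (Q := Q2) (famln (G a)) fQ2 sln lnD.
- by rewrite Q2B0.
- by rewrite Q2B0 sf0 -sh0 -add1n leq_add2r size_poly_gt0.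
exists (fun B => delta1 B * delta2 B * delta3 B * (u (e2 B) * peval (G a) (e2 B))).
split.
- apply: polyfunM; first by apply: polyfunM => //; apply: polyfunM.
  apply: polyfunM; apply: polyfun_comp => //; exact: polyfun_peval.
- by rewrite !mulf_neq0.
move=> v B d f Xv pB hf; rewrite !mulf_eq0 !negb_or.
move=> /andP[/andP[/andP[d1B d2B] d3B] /andP[uB GB]].
have [h [hE sh sf]] := factor v B d f Xv pB hf uB GB.
have sh_le : (size h <= size h0)%N.
  rewrite -Q1B0; apply: hd1 d1B _ _; first by rewrite hE dvdp_mulr.
  rewrite /Q1 (_ : \sum_b _ = h * \sum_b c b * line_poly (f b) (e1 B) (e2 B)).
    exact: dvdp_mulr.
  by rewrite mulr_sumr; apply: eq_bigr => b _; rewrite hE mulrCA.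
have sf_le : (size (line_poly (f a) (e1 B) (e2 B)) <= size f0a)%N.
  rewrite -Q2B0; apply: hd3 d3B _ _; first by rewrite hE dvdp_mull.
  exact: (hd2 v B d f).
(* The bound on [h] gives [d0 <= d] through [size h + d = D.+1]; the bound on [f_a] gives
   [d <= d0]. *)
move: sh sh0 sh_le sf_le; rewrite sf /f0a sf0 ltnS.
by move: (size h) (size h0) => s s0; clear; lia.
Qed.

End Family.
End Degree.

(** * Zariski neighborhoods in the Grassmannian *)

Section Neighborhoods.
Variables (k : closedFieldType) (T : vectType k).

(* Some homogeneous component [F_d] of [delta] does not vanish at [B0]; where
   [F_d(B) != 0], the polynomial [delta(t B)] in [t] is nonzero. *)
Lemma polyfun_nbhd (delta : T -> k) (L0 : proj_space T) (B0 : T) :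
  polyfun delta -> B0 \in (L0 : {vspace T}) -> delta B0 != 0 ->
  exists O : set (proj_space T), [/\ open O, O L0 &
    forall M : proj_space T, O M -> exists2 B, B \in (M : {vspace T}) & delta B != 0].
Proof.
move=> [F hF] BL dB0.
have FE x : peval F x = \sum_(d < msize F) peval (pihomog mdeg d F) x.
  rewrite {1}(pihomog_partitionE (leqnn (msize F))) /peval.
  by rewrite raddf_sum.
have [d Fd] : exists d : 'I_(msize F), peval (pihomog mdeg d F) B0 != 0.
  apply/existsP; apply: contraNT dB0 => /existsPn h.
  rewrite hF FE big1 // => d _; by have /negPn/eqP := h d.
exists (~` zero_locus [set pihomog mdeg d F]); split.
- by exists [set pihomog mdeg d F] => // _ ->; exists d; apply: pihomogP.
- by move=> /(_ _ erefl _ BL) /eqP; apply/negP.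
move=> M /existsNP[_ /not_implyP[-> /existsNP[x /not_implyP[xM /eqP Fx]]]].
apply: contrapT => h.
pose p := \poly_(e < msize F) peval (pihomog mdeg e F) x.
have p0 : p = 0.
  apply: poly_eq_horner => t; rewrite horner0 horner_poly.
  transitivity (delta (t *: x)).
    rewrite hF FE; apply: eq_bigr => e _.
    by rewrite (pevalZ _ _ (pihomogP _ _ _)) mulrC.
  apply: contrapT => /eqP dt; apply: h; exists (t *: x) => //.
  exact: rpredZ.
by move: Fx; have := coef_poly (msize F) (fun e => peval (pihomog mdeg e F) x) d;
  rewrite -/p p0 coef0 ltn_ord => <-; rewrite eqxx.
Qed.

End Neighborhoods.

(** * Planes recovered from their Pluecker coordinates *)

Section PlueckerRows.
Variables (k : closedFieldType) (V : vectType k).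

Let N := \dim (@fullv k V).

(** Contraction of a bivector with the [i]-th coordinate function: it yields vectors of the plane
    that depend linearly on the Pluecker coordinates. *)
Definition row_vect (i : 'I_N) (B : 'M[k]_N) : V :=
  \sum_l B i l *: (vbasis (@fullv k V))`_l.

Lemma row_vect_linear i : linear (row_vect i).
Proof.
move=> a B B'; rewrite /row_vect scaler_sumr -big_split /=; apply: eq_bigr => l _.
by rewrite !mxE scalerDl scalerA.
Qed.

Lemma coord_row_vect i l B : coord (vbasis (@fullv k V)) l (row_vect i B) = B i l.
Proof. by rewrite coord_sum_free // (basis_free (vbasisP _)). Qed.

Lemma row_vect_bivector i (x y : V) :
  row_vect i (bivector x y) =
  coord (vbasis fullv) i x *: y - coord (vbasis fullv) i y *: x.
Proof.
rewrite [X in _ = _ *: X - _](coord_vbasis (memvf y)).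
rewrite [X in _ = _ - _ *: X](coord_vbasis (memvf x)).
rewrite !scaler_sumr -sumrB; apply: eq_bigr => l _.
by rewrite mxE !scalerA -scalerBl; congr (_ *: _); rewrite [X in _ - X]mulrC.
Qed.

Lemma row_vect_mem (v : gr2 V) i B : B \in pluecker_line v -> row_vect i B \in (v : {vspace V}).
Proof.
have [hx hy] : (vbasis v)`_0 \in (v : {vspace V}) /\ (vbasis v)`_1 \in (v : {vspace V}).
  by split; apply/vbasis_mem/mem_nth; rewrite size_tuple (eqP (gr2_dim v)).
move=> /vlineP[c ->].
have -> : row_vect i (c *: bivector (vbasis v)`_0 (vbasis v)`_1) =
    c *: row_vect i (bivector (vbasis v)`_0 (vbasis v)`_1).
  by rewrite /row_vect scaler_sumr; apply: eq_bigr => l _; rewrite mxE scalerA.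
by rewrite row_vect_bivector rpredZ // rpredB // rpredZ.
Qed.

Lemma pluecker_alt (v : gr2 V) B i j : B \in pluecker_line v ->
  B j j = 0 /\ B j i = - B i j.
Proof.
move=> /vlineP[c ->]; rewrite !mxE; split; first by rewrite subrr mulr0.
by rewrite -[RHS]mulrN opprB.
Qed.

(** By alternation, the coordinates [i], [j] of row [i] are 0, [B i j] and those of row [j] are
    [- B i j], 0; hence the rows are independent. *)
Lemma row_vect_parametrizes (v : gr2 V) B i j : B \in pluecker_line v -> B i j != 0 ->
  parametrizes (row_vect i) (row_vect j) B v.
Proof.
move=> Bv Bij; have [Bjj Bji] := pluecker_alt i j Bv; split; try exact: row_vect_mem.
  apply: contraNneq Bij => r0; have := coord_row_vect j i B.
  by rewrite r0 linear0 Bji => /esym/eqP; rewrite oppr_eq0.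
move=> t; apply: contraNneq Bij => r0.
have := congr1 (coord (vbasis (@fullv k V)) j) r0.
by rewrite linearD linearZ /= !coord_row_vect Bjj mulr0 addr0 linear0 => ->.
Qed.

End PlueckerRows.

(** The fibre of [f] through [v] is open and closed in [X]; [U P] is the union of the open sets on
    whose trace on [X] the property [P] holds. *)
Lemma locally_constant_connected (T : topologicalType) (Y : Type) (X : set T) (f : T -> Y) :
  locally_constant_on X f -> connected X -> forall v w, X v -> X w -> f v = f w.
Proof.
move=> lc cX v w Xv Xw.
pose U (P : T -> Prop) :=
  \bigcup_(O in [set O : set T | open O /\ forall y, O y -> X y -> P y]) O.
have openU P : open (U P) by apply: bigcup_open => O [].
have Uin (P : T -> Prop) y : X y -> (forall z, f z = f y -> P z) -> U P y.
  move=> Xy Py; have [O [oO Oy hO]] := lc y Xy.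
  by exists O => //; split=> // z Oz Xz; apply/Py/hO.
have Uout P y : X y -> U P y -> P y by move=> Xy [O [_ hO] Oy]; apply: hO.
suff e : [set y | X y /\ f y = f v] = X.
  by have : [set y | X y /\ f y = f v] w by [rewrite e]; case.
apply: cX; first by exists v.
- exists (U (fun y => f y = f v)) => //; apply/seteqP; split=> y.
    by move=> [Xy fy]; split=> //; apply: Uin => // z ->.
  by move=> [Xy Uy]; split=> //; apply: Uout Uy.
exists (~` U (fun y => f y <> f v)); first exact: open_closedC.
apply/seteqP; split=> y.
  by move=> [Xy fy]; split=> //; move=> /(Uout _ _ Xy).
move=> [Xy nUy]; split=> //; apply: contrapT => fy; apply: nUy.
by apply: Uin => // z ->.
Qed.

Theorem theorem3p3 (k : closedFieldType) (p : nat) (g : vectType k)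
    (L : restrictedLieAlgebra p g) (X : set (gr2 g)) (m : nat)
    (phi : proj_space g -> proj_space 'rV[k]_m.+1) :
  p \in [pchar k] -> (3 <= p)%N ->
  closed X -> X `<=` gr2_null L ->
  morphism_on (projectivization (union_planes X)) phi ->
  locally_constant_on X (fun v : gr2 g => degree v phi) /\
  (connected X -> forall v w : gr2 g, X v -> X w -> degree v phi = degree w phi).
Proof.
move=> _ _ _ _ phiM.
have XA v : X v -> forall M : proj_space g, (M <= v)%VS ->
    projectivization (union_planes X) M.
  by move=> Xv M Mv x xM; exists v => //; apply: subvP Mv _ xM.
(* A degree exists, so [xget] returns one and not the default 0. *)
have degP v : X v -> is_degree v phi (degree v phi).
  by move=> Xv; apply: (xgetPex 0%N); apply: is_degree_exists phiM v (XA v Xv).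
suff lc : locally_constant_on X (fun v : gr2 g => degree v phi).
  by split=> // cX; apply: locally_constant_connected lc cX.
move=> v0 Xv0.
pose B0 := bivector (vbasis v0)`_0 (vbasis v0)`_1.
have B0v : B0 \in pluecker_line v0 by exact: memv_line.
(* A nonzero Pluecker coordinate of [v0] selects the two rows that parametrize the nearby planes. *)
have [i [j Bij]] : exists i j, B0 i j != 0.
  have : B0 != 0.
    by have := pluecker_dim v0; rewrite /pluecker_line -/B0 dim_vline; case: (B0 != 0).
  by move/matrix0Pn.
have form v : X v -> exists f : 'I_m.+1 -> {mpoly k[\dim v]}, degree_form phi (degree v phi) f.
  by move=> Xv; have [f [h1 _ h3]] := degP v Xv; exists f.
have [f0 hf0] := form v0 Xv0.
have [delta [pd dB0 hd]] := degree_constant_nearby phiM XA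
  (row_vect_linear i) (row_vect_linear j) Xv0 (row_vect_parametrizes B0v Bij) hf0.
have pBij : polyfun (fun B : 'M[k]_(\dim (@fullv k g)) => B i j).
  by apply: polyfun_linear => a B B'; rewrite !mxE.
(* [delta] need not be homogeneous, so a suitable representative [B] is chosen on each nearby
   Pluecker line; the factor [B i j] keeps the selected rows independent. *)
have [O [oO Ov0 hO]] := polyfun_nbhd (L0 := pluecker v0) (polyfunM pd pBij) B0v
  (mulf_neq0 dB0 Bij).
exists (@pluecker k g @^-1` O); split=> //.
  by exists O.
move=> v Ov Xv; have [B Bv] := hO _ Ov; rewrite mulf_eq0 negb_or => /andP[dB BBij].
have [f hf] := form v Xv.
exact: hd Xv (row_vect_parametrizes Bv BBij) hf dB.
Qed.
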